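(* Let $m\ge 2$ and $0\le s\le m$, $k\in\mathbb{N}_0$. Put $$\mathcal{I}_k^s=\mathrm{Ker}_k^s\underline{\partial}^+\oplus\big(\mathrm{Ker}_k^{s-1}\underline{\partial}^-\big)e_m .$$ (i) The Cauchy–Kovalevskaya extension operator $CK$ restricts to a linear isomorphism of $\mathcal{I}_k^s$ onto $\mathcal{H}_k^s(\mathbb{R}^m)$, and this isomorphism intertwines the H-action of $Pin(m-1)$. (ii) Moreover, if $u_0\in\mathrm{Ker}_k^s\underline{\partial}^+$ and $v_0\in\mathrm{Ker}_k^{s-1}\underline{\partial}^-$, then $$CK(u_0+v_0e_m)(\underline{\mathbf{x}},x_m)=\sum_{j=0}^k\frac{x_m^j}{j!}u_j(\underline{\mathbf{x}})+\sum_{j=0}^k\frac{x_m^j}{j!}v_j(\underline{\mathbf{x}})e_m,$$ where for $t\ge 0$ $$u_{2t}=(\underline{\partial}^+\underline{\partial}^-)^tu_0,\quad u_{2t+1}=(-1)^{s-1}(\underline{\partial}^+\underline{\partial}^-)^t\underline{\partial}^+v_0,$$ $$v_{2t}=(\underline{\partial}^-\underline{\partial}^+)^tv_0,\quad v_{2t+1}=(-1)^{s-1}(\underline{\partial}^-\underline{\partial}^+)^t\underline{\partial}^-u_0.$$ In addition, for every $p\in\mathcal{H}_k^s(\mathbb{R}^m)$, its restriction $p_0(\underline{\mathbf x})=p(\underline{\mathbf x},0)$ lies in $\mathcal I_k^s$ and $p=CK(p_0)$.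
   Context: $\mathcal{C}\ell_m$ denotes either the real Clifford algebra $\mathbb{R}_{0,m}$ or the complex Clifford algebra $\mathbb{C}_m$ generated by the standard basis $e_1,\dots,e_m$ of $\mathbb{R}^m$ with relations $e_ie_j+e_je_i=-2\delta_{ij}$; $\mathcal{C}\ell_m=\bigoplus_{s=0}^m\mathcal{C}\ell_m^s$, where $\mathcal{C}\ell_m^s$ is the space of $s$-vectors (spanned by the products $e_{i_1}\cdots e_{i_s}$, $i_1<\dots<i_s$). A point $\mathbf{x}=(x_1,\dots,x_m)$ is identified with the 1-vector $\sum_j x_je_j$. For a 1-vector $u$ and an $s$-vector $v$, $u\bullet v=\frac12(uv-(-1)^svu)$ and $u\wedge v=\frac12(uv+(-1)^svu)$, extended linearly in $v$. $\mathcal P_k^s(\mathbb R^m)$ is the space of $k$-homogeneous $\mathcal C\ell_m^s$-valued polynomials on $\mathbb R^m$ (zero if $k<0$ or $s\notin\{0,\dots,m\}$); $\mathcal{H}_k^s(\mathbb R^m)=\{P\in\mathcal{P}_k^s(\mathbb R^m):\partial P=0\}$ where $\partial=\sum_{j=1}^m e_j\partial_{x_j}$ acts from the left. The H-action of $Pin(m)$ on polynomials is $[H(r)P](\mathbf x)=rP(r^{-1}\mathbf x r)r^{-1}$; $Pin(m-1)\subset Pin(m)$ is generated by unit vectors in $\mathrm{span}(e_1,\dots,e_{m-1})$. Write $\underline{\mathbf{x}}=\sum_{j=1}^{m-1}x_je_j$, $\underline{\partial}=\sum_{j=1}^{m-1}e_j\partial_{x_j}$, $\underline{\partial}^+P=\sum_{j=1}^{m-1}e_j\wedge\partial_{x_j}P$,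 $\underline{\partial}^-P=\sum_{j=1}^{m-1}e_j\bullet\partial_{x_j}P$. $\mathcal{P}_k^s(\mathbb{R}^{m-1})$ denotes the $k$-homogeneous polynomials in $x_1,\dots,x_{m-1}$ with values in the $s$-vectors of the subalgebra $\mathcal{C}\ell_{m-1}$ generated by $e_1,\dots,e_{m-1}$, and $\mathrm{Ker}_k^s\underline{\partial}^{\pm}=\{u\in\mathcal{P}_k^s(\mathbb{R}^{m-1}):\underline{\partial}^{\pm}u=0\}$ (zero if $s<0$ or $s>m-1$). For a $\mathcal{C}\ell_m$-valued polynomial $p_0$ in $\underline{\mathbf x}$, the Cauchy–Kovalevskaya extension is $CK(p_0)(\underline{\mathbf{x}},x_m)=\sum_{j\ge 0}\frac{x_m^j}{j!}(e_m\underline{\partial})^jp_0(\underline{\mathbf{x}})$ (formally $e^{e_mx_m\underline\partial}p_0$). *)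

(* Defs.v *)
From HB Require Import structures.
From mathcomp Require Import all_boot all_order all_algebra.
Set Implicit Arguments. Unset Strict Implicit. Unset Printing Implicit Defensive.
Import Order.TTheory GRing.Theory Num.Theory.
Local Open Scope ring_scope.

(* Clifford algebra Cl_m over scalars F: coefficients on basis blades e_A,
   A a subset of {0..m-1} (e_A = e_{i1}...e_{is}, i1<...<is). *)
Notation Cl F m := {ffun {set 'I_m} -> F}.
Notation mi m := {ffun 'I_m -> nat}.
(* Cl_m-valued polynomials (power series) in x_1..x_m, by coefficients:
   P al is the coefficient of x^al. *)
Notation cpoly F m := (mi m -> Cl F m).

Definition blade {F : numFieldType} {m : nat} (C : {set 'I_m}) : Cl F m :=
  [ffun D : {set 'I_m} => (D == C)%:R].
Definition vec {F : numFieldType} {m : nat} (j : 'I_m) : Cl F m := blade [set j].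
Definition clscale {F : numFieldType} {m : nat} (c : F) (a : Cl F m) : Cl F m :=
  [ffun A : {set 'I_m} => c * a A].
Definition clone {F : numFieldType} {m : nat} : Cl F m := blade set0.

(* e_A e_B = (-1)^(inversions + |A cap B|) e_{A sym-diff B}, from e_ie_j+e_je_i=-2delta_ij *)
Definition clsign {F : numFieldType} {m : nat} (A B : {set 'I_m}) : F :=
  (-1) ^+ (#|[set p : 'I_m * 'I_m | (p.1 \in A) && (p.2 \in B) && (p.2 < p.1)%N]|
           + #|A :&: B|)%N.

Definition clmul {F : numFieldType} {m : nat} (a b : Cl F m) : Cl F m :=
  \sum_(A : {set 'I_m}) \sum_(B : {set 'I_m})
     clscale (a A * b B * clsign A B) (blade ((A :\: B) :|: (B :\: A))).

Definition gproj {F : numFieldType} {m : nat} (s : nat) (a : Cl F m) : Cl F m :=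
  [ffun A : {set 'I_m} => if #|A| == s then a A else 0].
(* a is an s-vector (s an integer; for s < 0 this forces a = 0) *)
Definition is_grade {F : numFieldType} {m : nat} (s : int) (a : Cl F m) : Prop :=
  forall A, a A != 0 -> (#|A|%:Z = s).

Definition dotv {F : numFieldType} {m : nat} (u v : Cl F m) : Cl F m :=
  \sum_(s < m.+1) clscale (2%:R^-1)
     (clmul u (gproj s v) - clscale ((-1) ^+ s) (clmul (gproj s v) u)).
Definition wedgev {F : numFieldType} {m : nat} (u v : Cl F m) : Cl F m :=
  \sum_(s < m.+1) clscale (2%:R^-1)
     (clmul u (gproj s v) + clscale ((-1) ^+ s) (clmul (gproj s v) u)).

(* the last index m-1 (0-based), i.e. e_m of the paper *)
Definition lastset (m : nat) : {set 'I_m} := [set i : 'I_m | val i == m.-1].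
Definition em {F : numFieldType} {m : nat} : Cl F m := blade (lastset m).
Definition low {m : nat} (i : 'I_m) : bool := (val i < m.-1)%N.
Definition alast {m : nat} (al : mi m) : nat := (\sum_(i : 'I_m | val i == m.-1) al i)%N.
Definition shiftm {m : nat} (j : nat) (al : mi m) : mi m :=
  [ffun i => if val i == m.-1 then (al i - j)%N else al i].

Definition pderiv {F : numFieldType} {m : nat} (j : 'I_m) (P : cpoly F m) : cpoly F m :=
  fun al => clscale (al j).+1%:R (P [ffun i => (al i + (i == j))%N]).
Definition dirac {F : numFieldType} {m : nat} (P : cpoly F m) : cpoly F m :=
  fun al => \sum_(j : 'I_m) clmul (vec j) (pderiv j P al).
Definition dunder {F : numFieldType} {m : nat} (P : cpoly F m) : cpoly F m :=
  fun al => \sum_(j : 'I_m | low j) clmul (vec j) (pderiv j P al).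
Definition dplus {F : numFieldType} {m : nat} (P : cpoly F m) : cpoly F m :=
  fun al => \sum_(j : 'I_m | low j) wedgev (vec j) (pderiv j P al).
Definition dminus {F : numFieldType} {m : nat} (P : cpoly F m) : cpoly F m :=
  fun al => \sum_(j : 'I_m | low j) dotv (vec j) (pderiv j P al).

Definition homog {F : numFieldType} {m : nat} (k : nat) (P : cpoly F m) : Prop :=
  forall al : mi m, P al != 0 -> (\sum_i al i)%N = k.
Definition pgrade {F : numFieldType} {m : nat} (s : int) (P : cpoly F m) : Prop :=
  forall al, is_grade s (P al).
Definition lowvar {F : numFieldType} {m : nat} (P : cpoly F m) : Prop :=
  forall (al : mi m) (i : 'I_m), val i = m.-1 -> al i != 0%N -> P al = 0.
Definition lowalg {F : numFieldType} {m : nat} (P : cpoly F m) : Prop :=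
  forall (al : mi m) (A : {set 'I_m}) (i : 'I_m), i \in A -> val i = m.-1 -> P al A = 0.

Definition Pks {F : numFieldType} {m : nat} (k : nat) (s : int) (P : cpoly F m) : Prop :=
  homog k P /\ pgrade s P.
Definition Hks {F : numFieldType} {m : nat} (k : nat) (s : int) (P : cpoly F m) : Prop :=
  Pks k s P /\ (forall al, dirac P al = 0).
Definition Pks_low {F : numFieldType} {m : nat} (k : nat) (s : int) (P : cpoly F m) : Prop :=
  Pks k s P /\ lowvar P /\ lowalg P.
Definition Kerplus {F : numFieldType} {m : nat} (k : nat) (s : int) (P : cpoly F m) : Prop :=
  Pks_low k s P /\ (forall al, dplus P al = 0).
Definition Kerminus {F : numFieldType} {m : nat} (k : nat) (s : int) (P : cpoly F m) : Prop :=
  Pks_low k s P /\ (forall al, dminus P al = 0).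

Definition padd {F : numFieldType} {m : nat} (P Q : cpoly F m) : cpoly F m :=
  fun al => P al + Q al.
Definition pscale {F : numFieldType} {m : nat} (c : F) (P : cpoly F m) : cpoly F m :=
  fun al => clscale c (P al).
Definition prmul {F : numFieldType} {m : nat} (P : cpoly F m) (a : Cl F m) : cpoly F m :=
  fun al => clmul (P al) a.

Definition Ispace {F : numFieldType} {m : nat} (k s : nat) (p0 : cpoly F m) : Prop :=
  exists u0 v0, Kerplus k s u0 /\ Kerminus k (s%:Z - 1) v0 /\
                p0 = padd u0 (prmul v0 em).

Definition mulxm {F : numFieldType} {m : nat} (j : nat) (P : cpoly F m) : cpoly F m :=
  fun al => if (j <= alast al)%N then P (shiftm j al) else 0.

Definition emd_iter {F : numFieldType} {m : nat} (j : nat) (p0 : cpoly F m) : cpoly F m :=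
  iter j (fun Q => fun al => clmul em (dunder Q al)) p0.

(* CK(p0) = sum_j x_m^j/j! (e_m dunder)^j p0, coefficientwise (finite for each al) *)
Definition CK {F : numFieldType} {m : nat} (p0 : cpoly F m) : cpoly F m :=
  fun al => \sum_(j < (alast al).+1) clscale (j`!%:R)^-1 (mulxm j (emd_iter j p0) al).

Definition series {F : numFieldType} {m : nat} (k : nat) (u : nat -> cpoly F m) : cpoly F m :=
  fun al => \sum_(j < k.+1) clscale (j`!%:R)^-1 (mulxm j (u j) al).

Definition pmd {F : numFieldType} {m : nat} (P : cpoly F m) : cpoly F m := dplus (dminus P).
Definition mdp {F : numFieldType} {m : nat} (P : cpoly F m) : cpoly F m := dminus (dplus P).

(* u_n and v_n; note (-1)^(s-1) = (-1)^(s+1) *)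
Definition useq {F : numFieldType} {m : nat} (s : nat) (u0 v0 : cpoly F m) (n : nat) : cpoly F m :=
  if odd n then pscale ((-1) ^+ s.+1) (iter n./2 pmd (dplus v0))
  else iter n./2 pmd u0.
Definition vseq {F : numFieldType} {m : nat} (s : nat) (u0 v0 : cpoly F m) (n : nat) : cpoly F m :=
  if odd n then pscale ((-1) ^+ s.+1) (iter n./2 mdp (dminus u0))
  else iter n./2 mdp v0.

Definition restr {F : numFieldType} {m : nat} (p : cpoly F m) : cpoly F m :=
  fun al => if alast al == 0%N then p al else 0.

(* evaluation of a k-homogeneous polynomial at x in F^m *)
Definition peval {F : numFieldType} {m : nat} (k : nat) (P : cpoly F m) (x : 'I_m -> F) : Cl F m :=
  \sum_(a : {ffun 'I_m -> 'I_k.+1} | (\sum_i (a i : nat))%N == k)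
     clscale (\prod_i x i ^+ a i) (P [ffun i => val (a i)]).
Definition xvec {F : numFieldType} {m : nat} (x : 'I_m -> F) : Cl F m :=
  \sum_j clscale (x j) (vec j).
Definition coords {F : numFieldType} {m : nat} (c : Cl F m) : 'I_m -> F :=
  fun j => c [set j].

Definition unitlow {F : numFieldType} {m : nat} (c : 'I_m -> F) : Prop :=
  (forall j, c j \is Num.real) /\ (forall j, ~~ low j -> c j = 0) /\
  \sum_j c j ^+ 2 = 1.
Definition pin_low {F : numFieldType} {m : nat} (r : Cl F m) : Prop :=
  exists cs : seq ('I_m -> F), (forall i, (i < size cs)%N -> unitlow (nth (fun _ => 0) cs i)) /\
    r = foldr (fun c acc => clmul (xvec c) acc) clone cs.

Definition hact_at {F : numFieldType} {m : nat} (k : nat) (r rinv : Cl F m) (P : cpoly F m)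
  (x : 'I_m -> F) : Cl F m :=
  clmul (clmul r (peval k P (coords (clmul (clmul rinv (xvec x)) r)))) rinv.

(* Main.v *)
Require Import Defs.
From HB Require Import structures.
From mathcomp Require Import all_boot all_order all_algebra.
From Stdlib Require Import FunctionalExtensionality.
From mathcomp Require Import ring zify.
Set Implicit Arguments. Unset Strict Implicit. Unset Printing Implicit Defensive.
Import Order.TTheory GRing.Theory Num.Theory.
Local Open Scope ring_scope.

(** The CK extension of [p0] is the only solution of [dirac p = 0] with [p = p0] on
    [x_m = 0]: the coefficient of [x_m^(j+1)] is forced to be [e_m dunder] applied to that
    of [x_m^j], up to a factorial.  On initial data [u + v e_m] with [u], [v] free of [e_m],
    of grades [s] and [s-1], [e_m dunder] has the grade-[s] part
    [+-(dplus v) +- (dminus u) e_m], and the remaining parts vanish exactly when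
    [dplus u = 0] and [dminus v = 0].  Since [dplus] and [dminus] square to zero, these two
    conditions persist, so the whole extension is [s]-vector valued; this also gives the
    explicit formula.

    For the Pin action, [x |-> r^-1 x r] is an orthogonal map [L] preserving the last axis up
    to a scalar [e].  By the chain rule [dunder] commutes with the H-action, and the factor
    [e] produced by [e_m r = e r e_m] is compensated by the action on [x_m]. *)

(** * Symmetric differences, blade signs and associativity of the Clifford product *)

Definition symd {m : nat} (A B : {set 'I_m}) : {set 'I_m} := (A :\: B) :|: (B :\: A).

Section Clifford.
Variables (F : numFieldType) (m : nat).
Implicit Types (A B C D : {set 'I_m}) (a b c u v w : Cl F m) (x y z : F).

Lemma in_symd A B i : (i \in symd A B) = (i \in A) (+) (i \in B).
Proof. by rewrite !inE; case: (i \in A); case: (i \in B). Qed.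

Lemma symdK A : involutive (symd A).
Proof. by move=> B; apply/setP=> i; rewrite !in_symd addbA addbb. Qed.

Lemma symdC A B : symd A B = symd B A.
Proof. by apply/setP=> i; rewrite !in_symd addbC. Qed.

Lemma symdA A B C : symd A (symd B C) = symd (symd A B) C.
Proof. by apply/setP=> i; rewrite !in_symd addbA. Qed.

Lemma symd0 A : symd A set0 = A.
Proof. by apply/setP=> i; rewrite !in_symd inE addbF. Qed.

Lemma symdd A : symd A A = set0.
Proof. by rewrite -{2}(symd0 A) symdK. Qed.

Lemma symd_eq A B C : (C == symd A B) = (B == symd A C).
Proof.
by apply/eqP/eqP=> ->; rewrite symdK.
Qed.

Lemma card_symd1 A j :
  #|symd [set j] A| = if j \in A then #|A|.-1 else #|A|.+1.
Proof.
case: ifPn => jA.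
  have -> : symd [set j] A = A :\ j.
    by apply/setP=> i; rewrite in_symd !inE; case: eqP => [->|]; rewrite ?jA.
  by rewrite (cardsD1 j A) jA.
have -> : symd [set j] A = j |: A.
  by apply/setP=> i; rewrite in_symd !inE; case: eqP => [->|]; rewrite ?(negPf jA).
by rewrite cardsU1 jA.
Qed.

(** The exponent [#|A :&: B|] supplies exactly the diagonal pairs, so strict inversions and
    intersection merge into a single product over pairs with [j <= i]. *)
Lemma clsignE A B :
  clsign A B = \prod_i \prod_j (-1) ^+ [&& i \in A, j \in B & (j <= i)%N] :> F.
Proof.
rewrite /clsign exprD -!prodr_const.
rewrite (eq_bigl (fun p : 'I_m * 'I_m => true && [&& p.1 \in A, p.2 \in B & (p.2 < p.1)%N]));
  last by move=> p; rewrite inE -andbA.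
rewrite [X in _ * X](big_mkcond (mem (A :&: B))) big_mkcondr /=.
rewrite -(pair_bigA _ (fun i j => if [&& i \in A, j \in B & (j < i)%N] then -1 else 1)) /=.
rewrite -big_split /=; apply: eq_bigr => i _.
rewrite (bigD1 i) //= [RHS](bigD1 i) //= ltnn leqnn !andbF andbT mul1r mulrC; congr (_ * _).
  by rewrite inE; case: (_ && _).
apply: eq_bigr => j ji; rewrite (leq_eqVlt j) val_eqE (negPf ji) /=.
by case: [&& _, _ & _].
Qed.

(** In the product form, each factor depends only on the parity of membership. With its mirror
    image, this makes [clsign] a bicharacter for symmetric difference. *)
Lemma clsignDl A B C : clsign (symd A B) C = clsign A C * clsign B C :> F.
Proof.
rewrite !clsignE -big_split; apply: eq_bigr => i _ /=.
rewrite -big_split; apply: eq_bigr => j _ /=.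
rewrite -signr_addb in_symd.
by case: (i \in A); case: (i \in B); case: (j \in C); case: (_ <= _)%N.
Qed.

Lemma clsignDr A B C : clsign C (symd A B) = clsign C A * clsign C B :> F.
Proof.
rewrite !clsignE -big_split; apply: eq_bigr => i _ /=.
rewrite -big_split; apply: eq_bigr => j _ /=.
rewrite -signr_addb in_symd.
by case: (i \in C); case: (j \in A); case: (j \in B); case: (_ <= _)%N.
Qed.

Lemma clsign0l A : clsign set0 A = 1 :> F.
Proof. by rewrite clsignE big1 // => i _; rewrite big1 // => j _; rewrite inE. Qed.

Lemma clsign0r A : clsign A set0 = 1 :> F.
Proof. by rewrite clsignE big1 // => i _; rewrite big1 // => j _; rewrite inE andbF. Qed.

Lemma clsign1l j A : clsign [set j] A = \prod_(i in A) (-1) ^+ (i <= j)%N :> F.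
Proof.
rewrite clsignE (bigD1 j) //= [X in _ * X]big1 ?mulr1; last first.
  by move=> i ij; rewrite big1 // => l _; rewrite inE (negPf ij).
rewrite [RHS]big_mkcond; apply: eq_bigr => i _; rewrite inE eqxx /=.
by case: (i \in A).
Qed.

Lemma clsign1r j A : clsign A [set j] = \prod_(i in A) (-1) ^+ (j <= i)%N :> F.
Proof.
rewrite clsignE [RHS]big_mkcond; apply: eq_bigr => i _.
rewrite (bigD1 j) //= big1 ?mulr1; last by move=> l lj; rewrite inE (negPf lj) /= andbF.
by rewrite inE eqxx /=; case: (i \in A).
Qed.

Lemma clsign11 (j : 'I_m) : clsign [set j] [set j] = -1 :> F.
Proof. by rewrite clsign1l big_set1 leqnn. Qed.

(** For [i] in [A] different from [j], exactly one of [i <= j], [j <= i] holds, which costs a factor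
    -1; for [i = j] both hold and the signs agree. *)
Lemma clsignC j A :
  clsign A [set j] = (-1) ^+ (#|A| + (j \in A)) * clsign [set j] A :> F.
Proof.
rewrite clsign1l clsign1r exprD.
have -> : (-1) ^+ (j \in A) = \prod_(i in A) (-1) ^+ (i == j) :> F.
  case: (boolP (j \in A)) => jA; last first.
    by rewrite big1 // => i iA; case: eqP => // ij; rewrite -ij iA in jA.
  rewrite (bigD1 j) //= eqxx big1 ?mulr1 // => i /andP[_ /negPf->] //.
rewrite -prodr_const -!big_split; apply: eq_bigr => i iA /=.
rewrite mulN1r.
case: (ltngtP i j) => ij; rewrite -?val_eqE /=.
- by rewrite ltn_eqF //= expr0 expr1 !mulN1r opprK.
- by rewrite gtn_eqF //= !expr0 expr1 mulr1.
- by rewrite ij eqxx !expr1; ring.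
Qed.

Lemma clmulE a b C :
  clmul a b C = \sum_A a A * b (symd A C) * clsign A (symd A C).
Proof.
rewrite /clmul sum_ffunE; apply: eq_bigr => A _.
rewrite sum_ffunE (bigD1 (symd A C)) //= big1 ?addr0; last first.
  move=> B; rewrite -symd_eq !ffunE => /negPf.
  by rewrite -/(symd A B) => ->; rewrite mulr0.
by rewrite !ffunE -/(symd A _) symdK eqxx mulr1.
Qed.

Lemma clscaleE x a A : clscale x a A = x * a A.
Proof. by rewrite ffunE. Qed.

Lemma clN a A : (- a) A = - a A.
Proof. by rewrite ffunE. Qed.

Lemma clD a b A : (a + b) A = a A + b A.
Proof. by rewrite ffunE. Qed.

Lemma clmulDl a b c : clmul (a + b) c = clmul a c + clmul b c.
Proof.
apply/ffunP=> C; rewrite [RHS]ffunE !clmulE -big_split; apply: eq_bigr => A _.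
by rewrite ffunE /=; ring.
Qed.

Lemma clmulDr a b c : clmul a (b + c) = clmul a b + clmul a c.
Proof.
apply/ffunP=> C; rewrite [RHS]ffunE !clmulE -big_split; apply: eq_bigr => A _.
by rewrite ffunE /=; ring.
Qed.

Lemma clmulZl x a b : clmul (clscale x a) b = clscale x (clmul a b).
Proof.
apply/ffunP=> C; rewrite clscaleE !clmulE mulr_sumr; apply: eq_bigr => A _.
by rewrite clscaleE; ring.
Qed.

Lemma clmulZr x a b : clmul a (clscale x b) = clscale x (clmul a b).
Proof.
apply/ffunP=> C; rewrite clscaleE !clmulE mulr_sumr; apply: eq_bigr => A _.
by rewrite clscaleE; ring.
Qed.

Lemma clmul0l a : clmul 0 a = 0.
Proof. by apply: (addrI (clmul 0 a)); rewrite -clmulDl !addr0. Qed.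

Lemma clmul0r a : clmul a 0 = 0.
Proof. by apply: (addrI (clmul a 0)); rewrite -clmulDr !addr0. Qed.

Lemma clmul_suml I (s : seq I) P (f : I -> Cl F m) b :
  clmul (\sum_(i <- s | P i) f i) b = \sum_(i <- s | P i) clmul (f i) b.
Proof.
by apply: (big_morph (fun a => clmul a b)); [move=> ? ?; rewrite clmulDl | rewrite clmul0l].
Qed.

Lemma clmul_sumr I (s : seq I) P (f : I -> Cl F m) b :
  clmul b (\sum_(i <- s | P i) f i) = \sum_(i <- s | P i) clmul b (f i).
Proof.
by apply: (big_morph (clmul b)); [move=> ? ?; rewrite clmulDr | rewrite clmul0r].
Qed.

Lemma clscaleD x a b : clscale x (a + b) = clscale x a + clscale x b.
Proof. by apply/ffunP=> A; rewrite !ffunE mulrDr. Qed.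

Lemma clscaleDl x y a : clscale (x + y) a = clscale x a + clscale y a.
Proof. by apply/ffunP=> A; rewrite !ffunE mulrDl. Qed.

Lemma clscale0 x : clscale x (0 : Cl F m) = 0.
Proof. by apply/ffunP=> A; rewrite !ffunE mulr0. Qed.

Lemma clscale0l a : clscale 0 a = 0.
Proof. by apply/ffunP=> A; rewrite !ffunE mul0r. Qed.

Lemma clscaleA x y a : clscale x (clscale y a) = clscale (x * y) a.
Proof. by apply/ffunP=> A; rewrite !ffunE mulrA. Qed.

Lemma clscale1 a : clscale 1 a = a.
Proof. by apply/ffunP=> A; rewrite !ffunE mul1r. Qed.

Lemma clscaleN1 a : clscale (-1) a = - a.
Proof. by apply/ffunP=> A; rewrite !ffunE mulN1r. Qed.

Lemma clscale_sumr I (s : seq I) P (f : I -> Cl F m) x :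
  clscale x (\sum_(i <- s | P i) f i) = \sum_(i <- s | P i) clscale x (f i).
Proof.
by apply: (big_morph (clscale x)); [move=> ? ?; rewrite clscaleD | rewrite clscale0].
Qed.

Lemma clscale_suml I (s : seq I) P (f : I -> F) a :
  clscale (\sum_(i <- s | P i) f i) a = \sum_(i <- s | P i) clscale (f i) a.
Proof.
by apply: (big_morph (fun x => clscale x a)); [move=> ? ?; rewrite clscaleDl | rewrite clscale0l].
Qed.

(** After reindexing, both sides sum over the same triples of blades, and the bicharacter property
    turns either sign into the product of the three pairwise signs. *)
Lemma clmulA a b c : clmul a (clmul b c) = clmul (clmul a b) c.
Proof.
apply/ffunP=> D; rewrite [LHS]clmulE [RHS]clmulE.
under [RHS]eq_bigr => A _ do rewrite clmulE !mulr_suml.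
rewrite exchange_big; apply: eq_bigr => A _ /=.
rewrite clmulE mulr_sumr mulr_suml (reindex_inj (inv_inj (symdK A))).
apply: eq_bigr => B _ /=.
set B' := symd A B; set C := symd B D.
have -> : B = symd A B' by rewrite symdK.
have -> : symd A D = symd B' C by rewrite /B' /C -symdA symdK.
by rewrite symdK clsignDl clsignDr; ring.
Qed.

Lemma clmul1l a : clmul clone a = a.
Proof.
apply/ffunP=> C; rewrite clmulE (bigD1 set0) //= big1 => [|A /negPf A0].
  by rewrite ffunE eqxx mul1r addr0 symdC symd0 clsign0l mulr1.
by rewrite ffunE A0 !mul0r.
Qed.

Lemma clmul1r a : clmul a clone = a.
Proof.
apply/ffunP=> C; rewrite clmulE (bigD1 C) //= big1 => [|A /negPf A0].
  by rewrite ffunE symdd eqxx addr0 clsign0r !mulr1.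
by rewrite ffunE eq_sym symd_eq symd0 eq_sym A0 mulr0 mul0r.
Qed.

Lemma vec_mulE j a C :
  clmul (vec j) a C = clsign [set j] (symd [set j] C) * a (symd [set j] C).
Proof.
rewrite clmulE (bigD1 [set j]) //= big1 => [|A /negPf A0].
  by rewrite ffunE eqxx addr0 mul1r mulrC.
by rewrite ffunE A0 !mul0r.
Qed.

Lemma mul_vecE j a C :
  clmul a (vec j) C = clsign (symd [set j] C) [set j] * a (symd [set j] C).
Proof.
rewrite clmulE (bigD1 (symd [set j] C)) //= big1 => [|A /negPf A0].
  by rewrite -symdA symdd symd0 ffunE eqxx addr0 mulr1 mulrC.
rewrite ffunE eq_sym symd_eq.
case: eqP => [E|]; rewrite ?mulr0 ?mul0r //.
by move: A0; rewrite E (symdC A) symdK eqxx.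
Qed.

End Clifford.

(** * Wedge and dot with a basis vector, as complementary parts of left multiplication *)

Section Vectors.
Variables (F : numFieldType) (m : nat).
Implicit Types (A B C D : {set 'I_m}) (a b c u v w : Cl F m) (x y z : F).
Implicit Types (i j : 'I_m).

Lemma mulr_half_double x : 2%:R^-1 * (x + x) = x.
Proof. by field. Qed.

Lemma vec_anticomm i j :
  clmul (vec i) (vec j) + clmul (vec j) (vec i)
  = clscale (if i == j then - 2%:R else 0) clone :> Cl F m.
Proof.
apply/ffunP=> C; rewrite [LHS]ffunE vec_mulE mul_vecE !ffunE clsignC.
have [D ->] : exists D, C = symd [set i] D by exists (symd [set i] C); rewrite symdK.
rewrite symdK.
case: (eqVneq D) => [->|Dj].
  rewrite cards1 inE; case: eqP => [->|/eqP ij].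
    by rewrite symdd eqxx clsign11 /=; ring.
  by rewrite /= addn0 expr1; ring.
rewrite !mulr0 addr0; case: eqP => [ij|]; rewrite ?mul0r //.
by rewrite eq_sym symd_eq symd0 ij (negPf Dj) mulr0.
Qed.

Lemma vec_sqr j : clmul (vec j) (vec j) = clscale (-1) clone :> Cl F m.
Proof.
apply/ffunP=> C; rewrite vec_mulE !ffunE eq_sym symd_eq symdd.
by case: eqP => [->|_]; rewrite ?mulr0 // symd0 clsign11.
Qed.

Lemma vec_vecK j a : clmul (vec j) (clmul (vec j) a) = - a.
Proof. by rewrite clmulA vec_sqr clmulZl clmul1l clscaleN1. Qed.

(** Treats the wedge ([x = 1]) and the dot ([x = -1]) at once. Only the grade of the blade [symd
    [set j] C] contributes; there the sign [(-1) ^+ s] cancels the cardinality in [clsignC]. For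
    these two values of [x] the resulting factor is 0 or 1, according to whether [j] lies in [C]. *)
Lemma gproj_sumE x j v C :
  (\sum_(s < m.+1) clscale (2%:R^-1)
     (clmul (vec j) (gproj s v) + clscale (x * (-1) ^+ s) (clmul (gproj s v) (vec j)))) C
  = 2%:R^-1 * (1 + x * (-1) ^+ (j \notin C)) * clmul (vec j) v C.
Proof.
have lt : (#|symd [set j] C| < m.+1)%N.
  by rewrite ltnS -[X in (_ <= X)%N]card_ord max_card.
rewrite sum_ffunE (bigD1 (Ordinal lt)) //= big1 => [|s].
  rewrite !ffunE vec_mulE mul_vecE vec_mulE !ffunE eqxx addr0 clsignC.
  rewrite in_symd inE eqxx addTb exprD.
  have e : (-1) ^+ #|symd [set j] C| * (-1) ^+ #|symd [set j] C| = 1 :> F.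
    by rewrite -expr2 sqrr_sign.
  by ring: e.
rewrite -val_eqE /= eq_sym => /negPf sC.
by rewrite !ffunE vec_mulE mul_vecE !ffunE sC !mulr0 addr0 mulr0.
Qed.

Lemma wedge_vecE j v C :
  wedgev (vec j) v C = if j \in C then clmul (vec j) v C else 0.
Proof.
rewrite /wedgev; under eq_bigr => s _ do rewrite -[(-1) ^+ s]mul1r.
rewrite gproj_sumE; case: ifP => _ /=; last by rewrite mul1r addrN mulr0 mul0r.
by rewrite -mulrA mulrDl !mul1r mulr_half_double.
Qed.

Lemma dot_vecE j v C :
  dotv (vec j) v C = if j \in C then 0 else clmul (vec j) v C.
Proof.
rewrite /dotv; under eq_bigr => s _ do
  rewrite -clscaleN1 clscaleA.
rewrite gproj_sumE; case: ifP => _ /=; first by rewrite mulr1 addrN mulr0 mul0r.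
by rewrite mulrNN mulr1 -mulrA mulrDl !mul1r mulr_half_double.
Qed.

Lemma wedgeD_dot j v : wedgev (vec j) v + dotv (vec j) v = clmul (vec j) v.
Proof.
by apply/ffunP=> C; rewrite ffunE wedge_vecE dot_vecE; case: ifP; rewrite ?addr0 ?add0r.
Qed.

Lemma wedgeZ j x v : wedgev (vec j) (clscale x v) = clscale x (wedgev (vec j) v).
Proof.
apply/ffunP=> C; rewrite clscaleE !wedge_vecE clmulZr clscaleE.
by case: ifP; rewrite ?mulr0.
Qed.

Lemma wedge_add j v w : wedgev (vec j) (v + w) = wedgev (vec j) v + wedgev (vec j) w.
Proof.
apply/ffunP=> C; rewrite ffunE !wedge_vecE clmulDr ffunE.
by case: ifP; rewrite ?addr0.
Qed.

Lemma dotZ j x v : dotv (vec j) (clscale x v) = clscale x (dotv (vec j) v).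
Proof.
apply/ffunP=> C; rewrite clscaleE !dot_vecE clmulZr clscaleE.
by case: ifP; rewrite ?mulr0.
Qed.

Lemma dot_add j v w : dotv (vec j) (v + w) = dotv (vec j) v + dotv (vec j) w.
Proof.
apply/ffunP=> C; rewrite ffunE !dot_vecE clmulDr ffunE.
by case: ifP; rewrite ?addr0.
Qed.

Lemma vec_vec_anti i j a : i != j ->
  clmul (vec i) (clmul (vec j) a) = - clmul (vec j) (clmul (vec i) a).
Proof.
move=> /negPf ij; apply/eqP; rewrite -addr_eq0 !clmulA -clmulDl vec_anticomm ij.
by rewrite clscale0l clmul0l.
Qed.

(** A double wedge is the double Clifford product cut down to the blades containing both indices,
    and it vanishes for equal indices; so the anticommutation of distinct basis vectors suffices. *)
Lemma wedge_anti i j a :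
  wedgev (vec i) (wedgev (vec j) a) = - wedgev (vec j) (wedgev (vec i) a).
Proof.
have E i' j' C : wedgev (vec i') (wedgev (vec j') a) C =
    if [&& i' != j', i' \in C & j' \in C] then clmul (vec i') (clmul (vec j') a) C else 0.
  rewrite wedge_vecE vec_mulE wedge_vecE in_symd inE [clmul (vec i') _ C]vec_mulE eq_sym.
  case: eqP => [<-|_] /=; last by case: (j' \in C); rewrite ?andbT ?andbF ?mulr0 ?if_same.
  by case: (i' \in C); rewrite ?mulr0.
apply/ffunP=> C; rewrite clN [LHS](E i j C) [X in - X](E j i C) [j == i]eq_sym [(j \in C) && _]andbC.
case: (eqVneq i j) => [_|ij] /=; first by rewrite oppr0.
by case: ifP => _; rewrite ?oppr0 // (vec_vec_anti a ij) clN.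
Qed.

Lemma dot_anti i j a :
  dotv (vec i) (dotv (vec j) a) = - dotv (vec j) (dotv (vec i) a).
Proof.
have E i' j' C : dotv (vec i') (dotv (vec j') a) C =
    if [&& i' != j', i' \notin C & j' \notin C] then clmul (vec i') (clmul (vec j') a) C else 0.
  rewrite dot_vecE vec_mulE dot_vecE in_symd inE [clmul (vec i') _ C]vec_mulE eq_sym.
  case: eqP => [<-|_] /=; last first.
    by case: (i' \in C); case: (j' \in C) => //=; rewrite mulr0.
  by case: (i' \in C); rewrite ?mulr0.
apply/ffunP=> C; rewrite clN [LHS](E i j C) [X in - X](E j i C) [j == i]eq_sym [(j \notin C) && _]andbC.
case: (eqVneq i j) => [_|ij] /=; first by rewrite oppr0.
by case: ifP => _; rewrite ?oppr0 // (vec_vec_anti a ij) clN.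
Qed.

End Vectors.

(** * First-order operators in the variables other than the last *)

Definition inc {m : nat} (j : 'I_m) (al : mi m) : mi m :=
  [ffun i => (al i + (i == j))%N].

Lemma incC m (i j : 'I_m) al : inc i (inc j al) = inc j (inc i al).
Proof. by apply/ffunP=> l; rewrite !ffunE addnAC. Qed.

Section FirstOrder.
Variables (F : numFieldType) (m : nat).
Implicit Types (P Q : cpoly F m) (al : mi m).

Lemma pderivC (i j : 'I_m) P al : pderiv i (pderiv j P) al = pderiv j (pderiv i P) al.
Proof.
rewrite /pderiv -!/(inc _ _) !clscaleA incC; congr (clscale _ _).
rewrite !ffunE (eq_sym j i); case: eqP => [->//|_].
by rewrite !addn0 mulrC.
Qed.

(* [dplus], [dminus] and [dunder] are the instances [T j = e_j wedge _],
   [e_j . _] and [e_j _] of this operator. *)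
Definition grad (T : 'I_m -> Cl F m -> Cl F m) P : cpoly F m :=
  fun al => \sum_(j : 'I_m | low j) T j (pderiv j P al).

Definition cl_linear (T : Cl F m -> Cl F m) :=
  (forall a b, T (a + b) = T a + T b) /\ (forall x a, T (clscale x a) = clscale x (T a)).

Lemma cl_linear0 T : cl_linear T -> T 0 = 0.
Proof. by move=> [TD _]; apply: (addrI (T 0)); rewrite -TD !addr0. Qed.

Lemma cl_linear_sum T I (s : seq I) p (f : I -> Cl F m) : cl_linear T ->
  T (\sum_(i <- s | p i) f i) = \sum_(i <- s | p i) T (f i).
Proof. by move=> Tlin; apply: (big_morph T Tlin.1); exact: cl_linear0. Qed.

Lemma cl_linear_wedge j : cl_linear (wedgev (vec j)).
Proof. by split=> *; rewrite ?wedge_add ?wedgeZ. Qed.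

Lemma cl_linear_dot j : cl_linear (dotv (vec j)).
Proof. by split=> *; rewrite ?dot_add ?dotZ. Qed.

Lemma cl_linear_mul a : cl_linear (clmul a).
Proof. by split=> *; rewrite ?clmulDr ?clmulZr. Qed.

(** Partial derivatives commute while the [T j] anticommute, so exchanging the two sums shows that
    the double sum equals its own negative. *)
Lemma grad_grad_eq0 T P al : (forall j, cl_linear (T j)) ->
  (forall i j a, T i (T j a) = - T j (T i a)) -> grad T (grad T P) al = 0.
Proof.
move=> Tlin Tanti.
have E : grad T (grad T P) al =
    \sum_(j : 'I_m | low j) \sum_(i : 'I_m | low i) T j (T i (pderiv i (pderiv j P) al)).
  apply: eq_bigr => j _; rewrite {1}/pderiv /grad clscale_sumr cl_linear_sum //.
  apply: eq_bigr => i _; rewrite pderivC; congr (T j _).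
  by rewrite [in RHS]/pderiv (Tlin i).2.
have : grad T (grad T P) al = - grad T (grad T P) al.
  rewrite {1}E exchange_big E -sumrN /=; apply: eq_bigr => j _.
  by rewrite -sumrN; apply: eq_bigr => i _; rewrite Tanti pderivC.
move/eqP; rewrite -addr_eq0 => /eqP E2; apply/ffunP=> C.
have := congr1 (fun a : Cl F m => a C) E2; rewrite !ffunE => /eqP.
by rewrite -mulr2n mulrn_eq0 /= => /eqP.
Qed.

Lemma dplus_dplus P al : dplus (dplus P) al = 0.
Proof. by apply: (grad_grad_eq0 (T := fun j => wedgev (vec j))); [exact: cl_linear_wedge | exact: wedge_anti]. Qed.

Lemma dminus_dminus P al : dminus (dminus P) al = 0.
Proof. by apply: (grad_grad_eq0 (T := fun j => dotv (vec j))); [exact: cl_linear_dot | exact: dot_anti]. Qed.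

Lemma pderivD j P Q al : pderiv j (padd P Q) al = pderiv j P al + pderiv j Q al.
Proof. by rewrite /pderiv clscaleD. Qed.

Lemma pderivZ j x P al : pderiv j (pscale x P) al = clscale x (pderiv j P al).
Proof. by rewrite /pderiv !clscaleA mulrC. Qed.

Lemma gradD T P Q al : (forall j, cl_linear (T j)) ->
  grad T (padd P Q) al = grad T P al + grad T Q al.
Proof.
move=> Tlin; rewrite -big_split; apply: eq_bigr => j _.
by rewrite pderivD (Tlin j).1.
Qed.

Lemma gradZ T x P al : (forall j, cl_linear (T j)) ->
  grad T (pscale x P) al = clscale x (grad T P al).
Proof.
move=> Tlin; rewrite clscale_sumr; apply: eq_bigr => j _.
by rewrite pderivZ (Tlin j).2.
Qed.

Lemma dplusZ x P al : dplus (pscale x P) al = clscale x (dplus P al).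
Proof. by apply: (gradZ (T := fun j => wedgev (vec j))); exact: cl_linear_wedge. Qed.

Lemma dminusZ x P al : dminus (pscale x P) al = clscale x (dminus P al).
Proof. by apply: (gradZ (T := fun j => dotv (vec j))); exact: cl_linear_dot. Qed.

Lemma dunderZ x P al : dunder (pscale x P) al = clscale x (dunder P al).
Proof. by apply: (gradZ (T := fun j => clmul (vec j))) => j; exact: cl_linear_mul. Qed.

Lemma dunderD P Q al : dunder (padd P Q) al = dunder P al + dunder Q al.
Proof. by apply: (gradD (T := fun j => clmul (vec j))) => j; exact: cl_linear_mul. Qed.

Lemma dunder_prmul P a al : dunder (prmul P a) al = clmul (dunder P al) a.
Proof.
rewrite /dunder clmul_suml; apply: eq_bigr => j _.
by rewrite /pderiv /prmul -clmulZl clmulA.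
Qed.

Lemma dunder_split P al : dunder P al = dplus P al + dminus P al.
Proof.
rewrite /dplus /dminus -big_split; apply: eq_bigr => j _ /=.
by rewrite wedgeD_dot.
Qed.

End FirstOrder.

(** * The last variable *)

Section LastVariable.
Variables (F : numFieldType) (n : nat).
Local Notation m := n.+1.
Local Notation last := (@ord_max n).
Implicit Types (P Q p u v : cpoly F m) (al : mi m) (A B C : {set 'I_m}).
Implicit Types (i j : 'I_m).

Definition emd P : cpoly F m := fun al => clmul em (dunder P al).

Lemma emd_iterS d P : emd_iter d.+1 P = emd (emd_iter d P).
Proof. by []. Qed.

Lemma val_lastE i : (val i == m.-1) = (i == last).
Proof. by rewrite -val_eqE. Qed.

Lemma lowE i : low i = (i != last).
Proof. by rewrite /low ltn_neqAle -ltnS ltn_ord andbT val_lastE. Qed.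

Lemma emE : em = vec last :> Cl F m.
Proof.
by congr blade; apply/setP=> i; rewrite !inE val_lastE.
Qed.

Lemma emK (a : Cl F m) : clmul em (clmul em a) = - a.
Proof. by rewrite emE vec_vecK. Qed.

Lemma alastE al : alast al = al last.
Proof. by rewrite /alast (big_pred1 last) // => i; rewrite val_lastE. Qed.

Lemma lowvarP P : lowvar P <-> forall al, al last != 0%N -> P al = 0.
Proof.
split=> [H al|H al i /eqP]; first exact: (H al last).
by rewrite val_lastE => /eqP ->; exact: H.
Qed.

Lemma lowalgP P : lowalg P <-> forall al A, last \in A -> P al A = 0.
Proof.
split=> [H al A lA|H al A i iA /eqP]; first exact: (H al A last).
by rewrite val_lastE => /eqP E; apply: H; rewrite -E.
Qed.

Lemma pgradeP t P : pgrade t P <-> forall al A, #|A|%:Z <> t -> P al A = 0.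
Proof.
split=> [H al A nA|H al A].
  by apply/eqP/negPn/negP => /H.
by move=> nz; apply/eqP; apply: contraNT nz => /eqP/H ->.
Qed.

Lemma inc_low j al : low j -> inc j al last = al last.
Proof. by rewrite lowE ffunE eq_sym => /negPf ->; rewrite addn0. Qed.

Lemma inc_last al : inc last al last = (al last).+1.
Proof. by rewrite ffunE eqxx addn1. Qed.

Lemma shiftm_last d al : shiftm d al last = (al last - d)%N.
Proof. by rewrite ffunE eqxx. Qed.

Lemma shiftm_low d j al : low j -> shiftm d al j = al j.
Proof. by rewrite lowE ffunE val_lastE => /negPf ->. Qed.

Lemma shiftm_inc_low d j al : low j -> shiftm d (inc j al) = inc j (shiftm d al).
Proof.
rewrite lowE => jl; apply/ffunP=> i; rewrite !ffunE val_lastE.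
by case: eqP => // ->; rewrite eq_sym (negPf jl) !addn0.
Qed.

Lemma shiftm_inc_last d al : shiftm d.+1 (inc last al) = shiftm d al.
Proof.
apply/ffunP=> i; rewrite !ffunE val_lastE.
by case: eqP => [_|_]; rewrite ?addn1 ?addn0.
Qed.

Lemma shiftm0 al : shiftm 0 al = al.
Proof. by apply/ffunP=> i; rewrite !ffunE subn0 if_same. Qed.

Lemma sum_shiftm d al : (d <= al last)%N ->
  (\sum_i shiftm d al i + d = \sum_i al i)%N.
Proof.
move=> dl; rewrite (bigD1 last) //= [RHS](bigD1 last) //= shiftm_last.
rewrite addnAC subnK //; congr (_ + _)%N.
by apply: eq_bigr => i il; rewrite shiftm_low // lowE.
Qed.

Lemma sum_inc j al : (\sum_i inc j al i = (\sum_i al i).+1)%N.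
Proof.
under eq_bigr => i _ do rewrite ffunE.
rewrite big_split /= -[RHS]addn1; congr (_ + _)%N.
by rewrite (bigD1 j) //= eqxx big1 // => i /negPf ->.
Qed.

Lemma lowvar_grad T P : (forall j, cl_linear (T j)) -> lowvar P -> lowvar (grad T P).
Proof.
move=> Tlin /lowvarP H; apply/lowvarP=> al al0; rewrite /grad big1 // => j jl.
by rewrite /pderiv -/(inc _ _) H ?inc_low // clscale0 cl_linear0.
Qed.

Lemma lowvar_emd P : lowvar P -> lowvar (emd P).
Proof.
move=> H; have /lowvarP H' : lowvar (dunder P).
  by apply: (lowvar_grad (T := fun j => clmul (vec j))) => // j; exact: cl_linear_mul.
by apply/lowvarP=> al /H'; rewrite /emd => ->; rewrite clmul0r.
Qed.

Lemma lowvar_emd_iter d P : lowvar P -> lowvar (emd_iter d P).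
Proof. by move=> H; elim: d => // d; apply: lowvar_emd. Qed.

Lemma lowvar_dplus P : lowvar P -> lowvar (dplus P).
Proof. by apply: (lowvar_grad (T := fun j => wedgev (vec j))) => j; exact: cl_linear_wedge. Qed.

Lemma lowvar_dminus P : lowvar P -> lowvar (dminus P).
Proof. by apply: (lowvar_grad (T := fun j => dotv (vec j))) => j; exact: cl_linear_dot. Qed.

Lemma dplusE P al C : dplus P al C =
  \sum_(j | low j && (j \in C)) clsign [set j] (symd [set j] C) *
     ((al j).+1%:R * P (inc j al) (symd [set j] C)).
Proof.
rewrite /dplus sum_ffunE big_mkcondr; apply: eq_bigr => j _.
by rewrite wedge_vecE vec_mulE /pderiv clscaleE.
Qed.

Lemma dminusE P al C : dminus P al C =
  \sum_(j | low j && (j \notin C)) clsign [set j] (symd [set j] C) *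
     ((al j).+1%:R * P (inc j al) (symd [set j] C)).
Proof.
rewrite /dminus sum_ffunE big_mkcondr; apply: eq_bigr => j _.
by rewrite dot_vecE vec_mulE /pderiv clscaleE; case: (j \in C).
Qed.

Lemma lowalg_dplus P : lowalg P -> lowalg (dplus P).
Proof.
move=> /lowalgP H; apply/lowalgP=> al C lC; rewrite dplusE big1 // => j /andP[].
rewrite lowE => jl _; rewrite H ?mulr0 // in_symd inE [last == j]eq_sym (negPf jl).
exact: lC.
Qed.

Lemma lowalg_dminus P : lowalg P -> lowalg (dminus P).
Proof.
move=> /lowalgP H; apply/lowalgP=> al C lC; rewrite dminusE big1 // => j /andP[].
rewrite lowE => jl _; rewrite H ?mulr0 // in_symd inE [last == j]eq_sym (negPf jl).
exact: lC.
Qed.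

Lemma pgrade_dplus (t : int) P : pgrade t P -> pgrade (t + 1) (dplus P).
Proof.
move=> /pgradeP H; apply/pgradeP=> al C Ct; rewrite dplusE big1 // => j /andP[_ jC].
rewrite H ?mulr0 //; rewrite card_symd1 jC.
(* The blade [C :\ j] has [#|C|.-1] elements; nonemptiness of [C] makes this truncated predecessor a
   genuine one. *)
have : (0 < #|C|)%N by apply/card_gt0P; exists j.
lia.
Qed.

Lemma pgrade_dminus (t : int) P : pgrade t P -> pgrade (t - 1) (dminus P).
Proof.
move=> /pgradeP H; apply/pgradeP=> al C Ct; rewrite dminusE big1 // => j /andP[_ /negPf jC].
by rewrite H ?mulr0 //; rewrite card_symd1 jC; lia.
Qed.

(** Moving [em] across a blade of cardinality [#|A|] that avoids it takes [#|A|] transpositions; the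
    hypothesis asks that all blades of [w] give the same sign. *)
Lemma em_comm x (w : Cl F m) : (forall A, w A != 0 -> last \notin A /\ (-1) ^+ #|A| = x) ->
  clmul em w = clscale x (clmul w em).
Proof.
move=> H; rewrite emE; apply/ffunP=> C; rewrite clscaleE vec_mulE mul_vecE clsignC.
set D := symd _ _; have [->|/H[/negPf -> <-]] := eqVneq (w D) 0; first by rewrite !mulr0.
by rewrite addn0 !mulrA -expr2 sqrr_sign mul1r.
Qed.

End LastVariable.

(** * The Cauchy-Kovalevskaya extension *)

Section CauchyKovalevskaya.
Variables (F : numFieldType) (n : nat).
Local Notation m := n.+1.
Local Notation last := (@ord_max n).
Implicit Types (P Q p u v : cpoly F m) (al : mi m) (A B C : {set 'I_m}).
Implicit Types (i j : 'I_m).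

Lemma emd_lin x y P Q :
  emd (padd (pscale x P) (pscale y Q)) = padd (pscale x (emd P)) (pscale y (emd Q)).
Proof.
apply: functional_extensionality => al.
by rewrite /emd dunderD !dunderZ clmulDr !clmulZr.
Qed.

Lemma emd_iter_lin d x y P Q :
  emd_iter d (padd (pscale x P) (pscale y Q))
  = padd (pscale x (emd_iter d P)) (pscale y (emd_iter d Q)).
Proof. by elim: d => // d IH; rewrite !emd_iterS IH emd_lin. Qed.

Lemma mulxmE d P al :
  mulxm d P al = if (d <= al last)%N then P (shiftm d al) else 0.
Proof. by rewrite /mulxm alastE. Qed.

Lemma mulxm_lin d x y P Q al : mulxm d (padd (pscale x P) (pscale y Q)) al
  = clscale x (mulxm d P al) + clscale y (mulxm d Q al).
Proof. by rewrite !mulxmE; case: ifP => // _; rewrite !clscale0 addr0. Qed.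

Lemma CK_lin x y P Q :
  CK (padd (pscale x P) (pscale y Q)) = padd (pscale x (CK P)) (pscale y (CK Q)).
Proof.
apply: functional_extensionality => al.
rewrite /CK /padd /pscale !clscale_sumr -big_split; apply: eq_bigr => j _ /=.
rewrite -!/(pscale _ _) -!/(padd _ _) emd_iter_lin mulxm_lin clscaleD !clscaleA.
by rewrite ![_^-1 * _]mulrC.
Qed.

(** Written with [+ d] instead of [k - d], so that a nonzero iterate also forces [d <= k]. *)
Lemma emd_iter_homog k d P al :
  homog k P -> emd_iter d P al != 0 -> (\sum_i al i + d = k)%N.
Proof.
move=> H; elim: d al => [|d IH] al; first by rewrite addn0; exact: H.
rewrite emd_iterS => nz.
have [j jnz] : exists j, emd_iter d P (inc j al) != 0.
  apply/existsP; apply: contraNT nz; rewrite negb_exists => /forallP Z.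
  rewrite /emd /dunder big1 ?clmul0r // => j _.
  by rewrite /pderiv -/(inc _ _) (eqP (negPn (Z j))) clscale0 clmul0r.
by rewrite -(IH _ jnz) sum_inc addSnnS.
Qed.

Lemma big_ord_support (V : zmodType) (f : nat -> V) a b :
  (forall l, (a < l)%N -> f l = 0) -> (forall l, (b < l)%N -> f l = 0) ->
  \sum_(l < a.+1) f l = \sum_(l < b.+1) f l.
Proof.
have W c d : (forall l, (c < l)%N -> f l = 0) ->
    \sum_(l < c.+1) f l = \sum_(l < (c + d).+1) f l.
  move=> fc; elim: d => [|d IH]; first by rewrite addn0.
  by rewrite addnS [RHS]big_ord_recr /= -IH fc ?addr0 // ltnS leq_addr.
by move=> fa fb; rewrite (W a b fa) (W b a fb) addnC.
Qed.

(** The cutoff in [CK] depends on the exponent of x_m, while [series] stops at [k]. Terms above the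
    first bound vanish by [mulxm], those above the second by degree. *)
Lemma CK_homogE k P al : homog k P ->
  CK P al = \sum_(j < k.+1) clscale (j`!%:R)^-1 (mulxm j (emd_iter j P) al).
Proof.
move=> H; apply: (big_ord_support (f := fun d => clscale (d`!%:R)^-1 (mulxm d (emd_iter d P) al))).
  by move=> i ia; rewrite /mulxm leqNgt ia clscale0.
move=> i ik; rewrite mulxmE; case: ifP => _; rewrite ?clscale0 //.
have [->|/(emd_iter_homog H)] := eqVneq (emd_iter i P (shiftm i al)) 0; first by rewrite clscale0.
lia.
Qed.

(** The iterates are free of x_m, so the only summand that reaches a given power of x_m is the one
    with that same index. *)
Lemma CK_lowvarE P al : lowvar P ->
  CK P al = clscale ((al last)`!%:R)^-1 (emd_iter (al last) P (shiftm (al last) al)).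
Proof.
move=> H; rewrite /CK alastE big_ord_recr /= mulxmE leqnn big1 ?add0r // => j _.
have /lowvarP Z := lowvar_emd_iter j H.
rewrite mulxmE ltnW // Z ?clscale0 // shiftm_last -lt0n subn_gt0.
exact: ltn_ord.
Qed.

Lemma diracE P al : dirac P al = dunder P al + clmul em (pderiv last P al).
Proof.
rewrite /dirac (bigD1 last) //= addrC -emE; congr (_ + _).
by apply: eq_bigl => j; rewrite lowE.
Qed.

Lemma factS_inv d : (d.+1)%:R * ((d.+1)`!%:R)^-1 = (d`!%:R)^-1 :> F.
Proof. by rewrite factS natrM invfM mulrA divff ?mul1r // pnatr_eq0. Qed.

(** [dunder] reads only the neighbours [inc j al] with [j] low, all with the same exponent of x_m.
    Restricting the hypothesis to them lets it be fed by an induction on that exponent. *)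
Lemma dunder_shiftE d P Q al x :
  (forall j, low j -> P (inc j al) = clscale x (Q (shiftm d (inc j al)))) ->
  dunder P al = clscale x (dunder Q (shiftm d al)).
Proof.
move=> H; rewrite /dunder clscale_sumr; apply: eq_bigr => j jl.
rewrite -clmulZr; congr clmul.
rewrite /pderiv -!/(inc _ _) H // shiftm_inc_low // !clscaleA shiftm_low //.
by rewrite mulrC.
Qed.

(** The derivative in x_m lowers the factorial and leaves one more [emd]; multiplying by [em] again
    gives minus the [dunder] term, since the square of e_m is -1. *)
Lemma dirac_CK P al : lowvar P -> dirac (CK P) al = 0.
Proof.
move=> H; rewrite diracE /pderiv -/(inc _ _) CK_lowvarE // inc_last shiftm_inc_last clscaleA factS_inv.
rewrite (dunder_shiftE (d := al last) (Q := emd_iter (al last) P) (x := ((al last)`!%:R)^-1)).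
  by rewrite emd_iterS clmulZr /emd emK -clscaleD addrN clscale0.
by move=> j jl; rewrite CK_lowvarE // inc_low.
Qed.

Lemma restr_CK P : lowvar P -> restr (CK P) = P.
Proof.
move=> H; apply: functional_extensionality => al; rewrite /restr alastE.
case: eqP => [al0|/eqP al0]; last by move/lowvarP: H => ->.
by rewrite CK_lowvarE // al0 shiftm0 fact0 invr1 clscale1.
Qed.

Lemma lowvar_restr P : lowvar (restr P).
Proof. by apply/lowvarP=> al al0; rewrite /restr alastE (negPf al0). Qed.

(** Induction on the exponent of x_m: the equation at [be] determines the coefficient at
    [inc last be]. *)
Lemma dirac_CK_restr P : (forall al, dirac P al = 0) -> P = CK (restr P).
Proof.
move=> H; apply: functional_extensionality => al.
rewrite CK_lowvarE; last exact: lowvar_restr.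
have [d ald] : exists d, al last = d by exists (al last).
rewrite ald; elim: d al ald => [|d IH] al ald.
  by rewrite shiftm0 /= /restr alastE ald /= invr1 clscale1.
have [be E] : exists be, al = inc last be.
  exists (shiftm 1 al); apply/ffunP=> i; rewrite !ffunE val_lastE.
  by case: eqP => [->|_]; rewrite ?addn0 // subnK // ald.
have bed : be last = d by move: ald; rewrite E inc_last => -[].
have := H be; rewrite diracE (dunder_shiftE (d := d) (Q := emd_iter d (restr P)) (x := (d`!%:R)^-1)).
  (* Left multiplication by [em] isolates the derivative in x_m, because e_m squares to -1. *)
  rewrite /pderiv -/(inc _ _) -E bed clmulZr => /(congr1 (clmul em)).
  rewrite clmulDr !clmulZr emK clmul0r => /eqP.
  rewrite -clscaleN1 clscaleA addrC mulrN1 => /eqP E2.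
  rewrite E shiftm_inc_last -E emd_iterS /emd.
  have d0 : d.+1%:R != 0 :> F by rewrite pnatr_eq0.
  apply/ffunP=> C; have := congr1 (fun a : Cl F m => a C) E2.
  rewrite factS natrM invfM clD !clscaleE [(0 : Cl F m) C]ffunE mulNr addrC => /eqP.
  by rewrite subr_eq0 -mulrA => /eqP ->; rewrite mulKf.
by move=> j jl; rewrite -IH // inc_low.
Qed.

End CauchyKovalevskaya.

(** * Initial data *)

Section InitialData.
Variables (F : numFieldType) (n : nat).
Local Notation m := n.+1.
Local Notation last := (@ord_max n).
Implicit Types (P Q p u v : cpoly F m) (al : mi m) (A B C : {set 'I_m}).
Implicit Types (i j : 'I_m) (s k : nat) (t : int).

(** [Kerplus] without homogeneity: the degree drops at each application of [emd], whereas these four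
    conditions survive it. *)
Definition plus_closed t u : Prop :=
  [/\ lowvar u, lowalg u, pgrade t u & forall al, dplus u al = 0].
Definition minus_closed t v : Prop :=
  [/\ lowvar v, lowalg v, pgrade t v & forall al, dminus v al = 0].

Lemma lowvarZ x P : lowvar P -> lowvar (pscale x P).
Proof. by move=> /lowvarP H; apply/lowvarP=> al /H E; rewrite /pscale E clscale0. Qed.

Lemma lowalgZ x P : lowalg P -> lowalg (pscale x P).
Proof.
by move=> /lowalgP H; apply/lowalgP=> al A /H E; rewrite /pscale clscaleE E mulr0.
Qed.

Lemma pgradeZ t x P : pgrade t P -> pgrade t (pscale x P).
Proof.
by move=> /pgradeP H; apply/pgradeP=> al A /H E; rewrite /pscale clscaleE E mulr0.
Qed.

(** Right multiplication by e_m appends the largest index to a blade without it, so no sign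
    appears. *)
Lemma mul_emE (w : Cl F m) C : (forall A, last \in A -> w A = 0) ->
  clmul w em C = if last \in C then w (symd [set last] C) else 0.
Proof.
move=> H; rewrite emE mul_vecE clsignC.
case: ifPn => lC; last by rewrite H ?mulr0 // in_symd inE eqxx.
rewrite -clsignC clsign1r big1 ?mul1r // => i iC; rewrite leqNgt.
have il : i != last by apply: contraTneq iC => ->; rewrite in_symd inE eqxx lC.
by rewrite -lowE in il; rewrite (il : (i < n)%N).
Qed.

Lemma mul_em_em (w : Cl F m) : clmul (clmul w em) em = - w.
Proof. by rewrite -clmulA emE vec_sqr clmulZr clmul1r clscaleN1. Qed.

Section Step.
Variables (s : nat) (u v : cpoly F m).
Hypotheses (Hu : plus_closed s u) (Hv : minus_closed (s%:Z - 1) v).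

(** The kernel conditions leave only [dminus u] and [(dplus v) em] in [dunder]. The first has grade
    s-1, so [em] passes it with sign [(-1) ^+ s.+1]; [em] passes [dplus v], of grade s, with sign
    [(-1) ^+ s], and the square of [em] adds one more -1. *)
Lemma emd_step : emd (padd u (prmul v em)) =
  padd (pscale ((-1) ^+ s.+1) (dplus v)) (prmul (pscale ((-1) ^+ s.+1) (dminus u)) em).
Proof.
case: Hu Hv => _ ua ug u0 [_ va vg v0]; apply: functional_extensionality => al.
rewrite /emd dunderD dunder_prmul !dunder_split u0 v0 add0r addr0 clmulDr.
rewrite (@em_comm _ _ ((-1) ^+ s.+1)) => [|A nz]; last first.
  split; first by apply: contraNN nz => lA; move/lowalg_dminus/lowalgP: ua => ->.
  have := pgrade_dminus ug nz => cA; have -> : s = #|A|.+1 by lia.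
  by rewrite !exprS !mulN1r opprK.
rewrite clmulA (@em_comm _ _ ((-1) ^+ s)) => [|A nz]; last first.
  split; first by apply: contraNN nz => lA; move/lowalg_dplus/lowalgP: va => ->.
  by have := pgrade_dplus vg nz => cA; have -> : s = #|A| by lia.
rewrite clmulZl mul_em_em /padd /prmul /pscale clmulZl addrC exprS mulN1r; congr (_ + _).
by rewrite -clscaleN1 clscaleA mulrN1.
Qed.

Lemma plus_closed_step : plus_closed s (pscale ((-1) ^+ s.+1) (dplus v)).
Proof.
case: Hv => vv va vg v0; split.
- exact/lowvarZ/lowvar_dplus.
- exact/lowalgZ/lowalg_dplus.
- by apply/pgradeZ; rewrite -[s%:Z](subrK 1); exact: pgrade_dplus.
- by move=> al; rewrite dplusZ dplus_dplus clscale0.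
Qed.

Lemma minus_closed_step : minus_closed (s%:Z - 1) (pscale ((-1) ^+ s.+1) (dminus u)).
Proof.
case: Hu => vv va vg v0; split.
- exact/lowvarZ/lowvar_dminus.
- exact/lowalgZ/lowalg_dminus.
- exact/pgradeZ/pgrade_dminus.
- by move=> al; rewrite dminusZ dminus_dminus clscale0.
Qed.

End Step.

(** Both sides are the same alternating word in [dminus] and [dplus], bracketed differently. *)
Lemma dminus_iter_pmd d P : dminus (iter d pmd P) = iter d mdp (dminus P).
Proof. elim: d => [//|d IH]; exact: (congr1 mdp IH). Qed.

Lemma dplus_iter_mdp d P : dplus (iter d mdp P) = iter d pmd (dplus P).
Proof. elim: d => [//|d IH]; exact: (congr1 pmd IH). Qed.

Lemma dplus_scale x P : dplus (pscale x P) = pscale x (dplus P).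
Proof. by apply: functional_extensionality => al; rewrite dplusZ. Qed.

Lemma dminus_scale x P : dminus (pscale x P) = pscale x (dminus P).
Proof. by apply: functional_extensionality => al; rewrite dminusZ. Qed.

Lemma pscale_signK d P : pscale ((-1) ^+ d) (pscale ((-1) ^+ d) P) = P.
Proof.
apply: functional_extensionality => al.
by rewrite /pscale clscaleA -expr2 sqrr_sign clscale1.
Qed.

(** Recasts the closed formulas as the one-step recursion of [emd_step]; from an odd index to the
    next even one the two signs cancel. *)
Lemma useqS s u v d : useq s u v d.+1 = pscale ((-1) ^+ s.+1) (dplus (vseq s u v d)).
Proof.
rewrite /useq /vseq /= uphalf_half; case: (odd d) => /=.
  by rewrite dplus_scale pscale_signK -dminus_iter_pmd.
by rewrite dplus_iter_mdp.
Qed.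

Lemma vseqS s u v d : vseq s u v d.+1 = pscale ((-1) ^+ s.+1) (dminus (useq s u v d)).
Proof.
rewrite /useq /vseq /= uphalf_half; case: (odd d) => /=.
  by rewrite dminus_scale pscale_signK -dplus_iter_mdp.
by rewrite dminus_iter_pmd.
Qed.

(** Closure is carried along with the formula because the next [emd_step] requires it. *)
Lemma emd_iter_seq s u v d : plus_closed s u -> minus_closed (s%:Z - 1) v ->
  [/\ emd_iter d (padd u (prmul v em)) = padd (useq s u v d) (prmul (vseq s u v d) em),
      plus_closed s (useq s u v d) & minus_closed (s%:Z - 1) (vseq s u v d)].
Proof.
move=> Hu Hv; elim: d => [//|d [E Ku Kv]].
rewrite emd_iterS E useqS vseqS; split.
- exact: emd_step.
- exact: plus_closed_step.
- exact: minus_closed_step.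
Qed.

Lemma Kerplus_closed k t u : Kerplus k t u -> plus_closed t u.
Proof. by move=> [[[_ ?] [? ?]] ?]. Qed.

Lemma Kerminus_closed k t v : Kerminus k t v -> minus_closed t v.
Proof. by move=> [[[_ ?] [? ?]] ?]. Qed.

Lemma homogD_mulem k u v : homog k u -> homog k v -> homog k (padd u (prmul v em)).
Proof.
move=> hu hv al; have [u0|/hu //] := eqVneq (u al) 0.
have [v0|/hv //] := eqVneq (v al) 0.
by rewrite /padd /prmul u0 v0 clmul0l addr0 eqxx.
Qed.

Lemma lowvarD_mulem u v : lowvar u -> lowvar v -> lowvar (padd u (prmul v em)).
Proof.
move=> /lowvarP hu /lowvarP hv; apply/lowvarP=> al al0.
by rewrite /padd /prmul hu // hv // clmul0l addr0.
Qed.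

Lemma CK_formula k s u v : Kerplus k s u -> Kerminus k (s%:Z - 1) v ->
  CK (padd u (prmul v em)) =
  padd (series k (useq s u v)) (prmul (series k (vseq s u v)) em).
Proof.
move=> Hu Hv; apply: functional_extensionality => al.
rewrite (@CK_homogE _ _ k); last by apply: homogD_mulem; [case: Hu => -[[]] | case: Hv => -[[]]].
rewrite /padd /prmul /series clmul_suml -big_split; apply: eq_bigr => j _ /=.
have [E _ _] := emd_iter_seq j (Kerplus_closed Hu) (Kerminus_closed Hv).
rewrite -!/(prmul _ _) -!/(padd _ _) E clmulZl -clscaleD; congr clscale.
by rewrite /mulxm; case: ifP => // _; rewrite clmul0l addr0.
Qed.

Lemma Ispace_lowvar k s p : Ispace k s p -> lowvar p.
Proof.
move=> [u [v [/Kerplus_closed[hu _ _ _] [/Kerminus_closed[hv _ _ _] ->]]]].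
exact: lowvarD_mulem.
Qed.

Lemma pgradeD_mulem s u v : plus_closed s u -> minus_closed (s%:Z - 1) v ->
  pgrade s (padd u (prmul v em)).
Proof.
move=> [_ _ /pgradeP ug _] [_ /lowalgP va /pgradeP vg _]; apply/pgradeP=> al C Cs.
rewrite /padd /prmul clD ug // add0r mul_emE; last exact: va.
case: ifP => // lC; apply: vg; rewrite card_symd1 lC.
have : (0 < #|C|)%N by apply/card_gt0P; exists last.
lia.
Qed.

Lemma CK_Hks k s p : Ispace k s p -> Hks k s (CK p).
Proof.
move=> Ip; have lp := Ispace_lowvar Ip; case: Ip => u [v [Hu [Hv Ep]]].
have hp : homog k p by rewrite Ep; apply: homogD_mulem; [case: Hu => -[[]] | case: Hv => -[[]]].
split; last by move=> al; exact: dirac_CK.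
split=> [al|].
  rewrite CK_lowvarE // => nz.
  have /(emd_iter_homog hp) : emd_iter (al last) p (shiftm (al last) al) != 0.
    by apply: contraNN nz => /eqP ->; rewrite clscale0.
  by rewrite sum_shiftm.
apply/pgradeP=> al C Cs; rewrite CK_lowvarE // clscaleE Ep.
have [-> Ku Kv] := emd_iter_seq (al last) (Kerplus_closed Hu) (Kerminus_closed Hv).
by move/pgradeP: (pgradeD_mulem Ku Kv) => ->; rewrite ?mulr0.
Qed.

(** Restriction to x_m = 0 is a left inverse of [CK]. *)
Lemma CK_Ispace_inj k s p q : Ispace k s p -> Ispace k s q -> CK p = CK q -> p = q.
Proof.
move=> /Ispace_lowvar lp /Ispace_lowvar lq E.
by rewrite -(restr_CK lp) -(restr_CK lq) E.
Qed.

(** * Splitting off e_m and recovering the initial data of a null solution *)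

Definition lowpart p : cpoly F m :=
  fun al => [ffun A : {set 'I_m} => if last \in A then 0 else p al A].
(** The factor c in the decomposition b + c e_m; as [mul_emE] carries no sign, its coefficients are
    read off directly. *)
Definition toppart p : cpoly F m :=
  fun al => [ffun A : {set 'I_m} => if last \in A then 0 else p al (symd [set last] A)].

Lemma lowalg_lowpart p : lowalg (lowpart p).
Proof. by apply/lowalgP=> al A lA; rewrite ffunE lA. Qed.

Lemma lowalg_toppart p : lowalg (toppart p).
Proof. by apply/lowalgP=> al A lA; rewrite ffunE lA. Qed.

Lemma split_last p : p = padd (lowpart p) (prmul (toppart p) em).
Proof.
apply: functional_extensionality => al; apply/ffunP=> C.
rewrite /padd /prmul clD mul_emE; last by move=> A; exact: (lowalgP _).1 (lowalg_toppart p) al A.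
rewrite !ffunE in_symd inE eqxx symdK.
by case: (last \in C); rewrite ?addr0 ?add0r.
Qed.

Lemma Pks_lowpart k s p : Pks k s p -> lowvar p -> Pks_low k s (lowpart p).
Proof.
move=> [hp /pgradeP gp] /lowvarP lp.
have Z al : p al = 0 -> lowpart p al = 0.
  by move=> E; apply/ffunP=> A; rewrite !ffunE E ffunE if_same.
split; last by split; [apply/lowvarP=> al /lp/Z | exact: lowalg_lowpart].
split=> [al nz|]; first by apply: hp; apply: contraNN nz => /eqP/Z ->.
by apply/pgradeP=> al A /gp E; rewrite ffunE E if_same.
Qed.

Lemma Pks_toppart k s p : Pks k s p -> lowvar p -> Pks_low k (s%:Z - 1) (toppart p).
Proof.
move=> [hp /pgradeP gp] /lowvarP lp.
have Z al : p al = 0 -> toppart p al = 0.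
  by move=> E; apply/ffunP=> A; rewrite !ffunE E ffunE if_same.
split; last by split; [apply/lowvarP=> al /lp/Z | exact: lowalg_toppart].
split=> [al nz|]; first by apply: hp; apply: contraNN nz => /eqP/Z ->.
apply/pgradeP=> al A As; rewrite ffunE; case: ifPn => // lA.
by apply: gp; rewrite card_symd1 (negPf lA); lia.
Qed.

(* In [e_m dunder p0] the parts [e_m (dplus u0)] and [e_m (dminus v0) e_m] are the
   only ones of grade different from [s], so both vanish as soon as it is an [s]-vector. *)
Lemma Ispace_of_emd k s p : Pks k s p -> lowvar p -> pgrade s (emd p) -> Ispace k s p.
Proof.
move=> Pp lp ge; exists (lowpart p), (toppart p).
have Ku := Pks_lowpart Pp lp; have Kv := Pks_toppart Pp lp.
(* Up to sign, left multiplication by [em] permutes the coefficients, so the grade condition on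
   [emd p] becomes a vanishing condition on [dunder p]. *)
have w0 al C : #|symd [set last] C|%:Z <> s -> dunder p al C = 0.
  move=> Cs; have := (pgradeP _ _).1 ge al _ Cs.
  rewrite /emd emE vec_mulE symdK => /eqP; rewrite mulf_eq0 => /orP[|/eqP //].
  by rewrite /clsign signr_eq0.
have wE al C : dunder p al C = if last \in C
    then dplus (toppart p) al (symd [set last] C) + dminus (toppart p) al (symd [set last] C)
    else dplus (lowpart p) al C + dminus (lowpart p) al C.
  have /lowalgP la := lowalg_dplus (lowalg_lowpart p).
  have /lowalgP lb := lowalg_dminus (lowalg_lowpart p).
  have /lowalgP lc := lowalg_dplus (lowalg_toppart p).
  have /lowalgP ld := lowalg_dminus (lowalg_toppart p).
  rewrite {1}(split_last p) dunderD dunder_prmul !dunder_split !clD mul_emE => [|A lA].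
    by case: ifP => lC; rewrite ?addr0 // la // lb // !add0r clD.
  by rewrite clD lc // ld // addr0.
case: Ku (Ku) => -[_ /pgradeP gu] [_ la] Ku; case: Kv (Kv) => -[_ gv] [_ lb] Kv.
have gu' := (pgradeP _ _).2 gu.
split; [split=> // al|split; [split=> // al|exact: split_last]]; apply/ffunP=> C; rewrite [RHS]ffunE.
  case: (boolP (last \in C)) => lC; first exact: (lowalgP _).1 (lowalg_dplus la) _ _ lC.
  (* Only grade s+1 can survive. There [em] would produce grade s+2, so [dunder p] vanishes, and
     [dminus] of the low part, of grade s-1, does not interfere. *)
  have [Cs|/eqP Cs] := eqVneq (#|C|%:Z) (s%:Z + 1); last first.
    exact: (pgradeP _ _).1 (pgrade_dplus gu') _ _ Cs.
  have := wE al C; rewrite (negPf lC) w0; last by rewrite card_symd1 (negPf lC); lia.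
  rewrite ((pgradeP _ _).1 (pgrade_dminus gu') al C) ?addr0 //; lia.
case: (boolP (last \in C)) => lC; first exact: (lowalgP _).1 (lowalg_dminus lb) _ _ lC.
(* Dually, only grade s-2 can survive; the relation is read at the blade [C] with e_m adjoined,
   where [dplus] of the top part, of grade s, does not contribute. *)
have [Cs|/eqP Cs] := eqVneq (#|C|%:Z) (s%:Z - 1 - 1); last first.
  exact: (pgradeP _ _).1 (pgrade_dminus gv) _ _ Cs.
have := wE al (symd [set last] C); rewrite in_symd inE eqxx (negPf lC) /= symdK w0.
  rewrite ((pgradeP _ _).1 (pgrade_dplus gv) al C) ?add0r //; lia.
rewrite symdK; lia.
Qed.

Lemma Hks_restr k s p : Hks k s p -> Ispace k s (restr p) /\ p = CK (restr p).
Proof.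
move=> [[hp gp] /dirac_CK_restr E]; split=> //.
have lr := lowvar_restr p; apply: Ispace_of_emd => //.
  split=> [al|al A]; rewrite /restr; case: ifP => _; rewrite ?eqxx //; first exact: hp.
    exact: gp.
  by rewrite ffunE eqxx.
apply/pgradeP=> al A As; have [al0|al0] := eqVneq (al last) 0%N; last first.
  by rewrite ((lowvarP _).1 (lowvar_emd lr)) // ffunE.
(* The coefficient of the first power of x_m in [p] is [emd (restr p)], which therefore inherits the
   grade of [p]. *)
move/pgradeP: gp => /(_ (inc last al) A As); rewrite {1}E CK_lowvarE //.
by rewrite inc_last al0 shiftm_inc_last shiftm0 /= invr1 clscale1.
Qed.

End InitialData.

(** * Conjugation by the Pin group *)

Section Pin.
Variables (F : numFieldType) (n : nat).
Local Notation m := n.+1.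
Local Notation last := (@ord_max n).
Implicit Types (r : Cl F m) (c x y : 'I_m -> F) (L : 'I_m -> 'I_m -> F) (i j l : 'I_m).

Lemma xvecE x i : xvec x [set i] = x i.
Proof.
rewrite /xvec sum_ffunE (bigD1 i) //= big1 ?addr0 => [|j ji].
  by rewrite !ffunE eqxx mulr1.
by rewrite !ffunE (inj_eq set1_inj) [i == j]eq_sym (negPf ji) mulr0.
Qed.

Lemma xvec_single (z : F) i : xvec (fun j => if j == i then z else 0) = clscale z (vec i).
Proof.
rewrite /xvec (bigD1 i) //= eqxx big1 ?addr0 // => j /negPf ->.
exact: clscale0l.
Qed.

Lemma xvec_anticomm c j :
  clmul (vec j) (xvec c) = clscale (-1) (clmul (xvec c) (vec j)) + clscale (- 2%:R * c j) clone.
Proof.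
apply/eqP; rewrite clscaleN1 addrC -subr_eq opprK; apply/eqP.
rewrite /xvec clmul_sumr clmul_suml -big_split (bigD1 j) //= big1 ?addr0 => [|i ij].
  by rewrite clmulZl clmulZr -clscaleD vec_anticomm eqxx clscaleA mulrC.
by rewrite clmulZl clmulZr -clscaleD vec_anticomm eq_sym (negPf ij) clscale0l clscale0.
Qed.

Lemma xvec_sqr c : clmul (xvec c) (xvec c) = clscale (- \sum_j c j ^+ 2) clone.
Proof.
have : clmul (xvec c) (xvec c) + clmul (xvec c) (xvec c) =
    clscale (- 2%:R * \sum_j c j ^+ 2) clone.
  have E1 : clmul (xvec c) (xvec c) = \sum_j clscale (c j) (clmul (vec j) (xvec c)).
    by rewrite {1}/xvec clmul_suml; apply: eq_bigr => j _; rewrite clmulZl.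
  have E2 : clmul (xvec c) (xvec c) = \sum_j clscale (c j) (clmul (xvec c) (vec j)).
    by rewrite {2}/xvec clmul_sumr; apply: eq_bigr => j _; rewrite clmulZr.
  rewrite {1}E1 E2 -big_split mulr_sumr clscale_suml; apply: eq_bigr => j _ /=.
  rewrite -clscaleD xvec_anticomm clscaleN1 addrAC addNr add0r clscaleA.
  by congr clscale; ring.
move=> E; apply/ffunP=> A; have := congr1 (fun a : Cl F m => a A) E.
rewrite clD !clscaleE => E2; rewrite -[LHS]mulr_half_double E2; by field.
Qed.

(* [L] is the matrix of [x |-> r^-1 x r]; the second equation says that its inverse is
   its transpose.  The last two say that the last axis is preserved. *)
Definition intertwines L (e : F) r : Prop :=
  [/\ forall j, clmul (vec j) r = clmul r (xvec (L ^~ j)),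
      forall i, clmul r (vec i) = clmul (xvec (L i)) r,
      forall i, L i last = if i == last then e else 0
    & forall j, L last j = if j == last then e else 0].

Lemma intertwines_one : intertwines (fun i j => (i == j)%:R) 1 clone.
Proof.
have E i : xvec (fun j => (j == i)%:R) = vec i :> Cl F m.
  rewrite -[RHS]clscale1 -xvec_single; congr xvec.
  by apply: functional_extensionality => j; case: eqP.
split=> [j|i|i|j].
- by rewrite E clmul1l clmul1r.
- rewrite clmul1l clmul1r -[LHS]E; congr xvec.
  by apply: functional_extensionality => j; rewrite eq_sym.
- by case: eqP.
- by rewrite eq_sym; case: eqP.
Qed.

(** Conjugation by a unit vector fixes [c] and negates its orthogonal complement, whence the matrix
    [2 c c^T - 1]; the last axis lies in that complement, which gives the scalar -1. *)
Lemma intertwines_unit c : unitlow c ->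
  intertwines (fun i j => 2%:R * c i * c j - (i == j)%:R) (-1) (xvec c).
Proof.
move=> [_ [cl c1]].
have cl0 : c last = 0 by apply: cl; rewrite lowE eqxx.
have E j : xvec (fun i => 2%:R * c i * c j - (i == j)%:R)
    = clscale (2%:R * c j) (xvec c) + clscale (-1) (vec j) :> Cl F m.
  rewrite -xvec_single /xvec clscale_sumr -big_split; apply: eq_bigr => i _ /=.
  by rewrite clscaleA -clscaleDl; congr clscale; case: eqP => _ /=; ring.
have E' j : xvec (fun i => 2%:R * c j * c i - (j == i)%:R)
    = clscale (2%:R * c j) (xvec c) + clscale (-1) (vec j) :> Cl F m.
  rewrite -E; congr xvec; apply: functional_extensionality => i.
  by rewrite mulrAC [j == i]eq_sym.
split=> [j|i|i|j].
- rewrite E clmulDr !clmulZr xvec_sqr c1 xvec_anticomm addrC clscaleA; congr (_ + _).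
  by congr clscale; ring.
- rewrite E' clmulDl !clmulZl xvec_sqr c1 xvec_anticomm clscaleD !clscaleA.
  by apply/ffunP=> A; rewrite !clD !clscaleE; ring.
- by rewrite cl0 mulr0 sub0r; case: eqP; rewrite ?oppr0.
- by rewrite cl0 mulr0 mul0r sub0r [_ == j]eq_sym; case: eqP; rewrite ?oppr0.
Qed.

Lemma xvec_sum (I : finType) (a : I -> F) (y : I -> 'I_m -> F) :
  xvec (fun i => \sum_l a l * y l i) = \sum_l clscale (a l) (xvec (y l)).
Proof.
rewrite /xvec; under eq_bigr => i _ do rewrite clscale_suml.
rewrite exchange_big; apply: eq_bigr => l _; rewrite clscale_sumr.
by apply: eq_bigr => i _; rewrite clscaleA.
Qed.

(** Conjugation by [r r'] applies [r] first and [r'] second, hence the matrix product with [L'] on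
    the left. *)
Lemma intertwines_mul L e L' e' r r' : intertwines L e r -> intertwines L' e' r' ->
  intertwines (fun i j => \sum_l L' i l * L l j) (e' * e) (clmul r r').
Proof.
move=> [V1 V2 V3 V4] [W1 W2 W3 W4]; split=> [j|i|i|j].
- rewrite clmulA V1 -clmulA {1}/xvec clmul_suml -clmulA; congr clmul.
  under eq_bigr => i _ do rewrite clmulZl W1 -clmulZr.
  rewrite -clmul_sumr; congr clmul; rewrite -xvec_sum; congr xvec.
  by apply: functional_extensionality => i; apply: eq_bigr => l _; rewrite mulrC.
- rewrite -clmulA W2 clmulA {1}/xvec clmul_sumr clmulA; congr clmul.
  under eq_bigr => j _ do rewrite clmulZr V2 -clmulZl.
  by rewrite -clmul_suml -xvec_sum.
- rewrite (bigD1 last) //= big1 ?addr0 => [|l /negPf ll].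
    by rewrite V3 eqxx W3; case: eqP; rewrite ?mul0r.
  by rewrite V3 ll mulr0.
- rewrite (bigD1 last) //= big1 ?addr0 => [|l /negPf ll].
    by rewrite W4 eqxx V4; case: eqP; rewrite ?mulr0.
  by rewrite W4 ll mul0r.
Qed.

Lemma pin_low_intertwines r : pin_low r -> exists L e, intertwines L e r.
Proof.
move=> [cs [H ->]]; elim: cs H => [|c cs IH] H /=.
  by exists (fun i j => (i == j)%:R), 1; exact: intertwines_one.
have [|L' [e' HL']] := IH; first by move=> i ics; exact: (H i.+1).
have HL := intertwines_unit (H 0%N isT).
by eexists; eexists; exact: intertwines_mul HL HL'.
Qed.

Definition lact L x : 'I_m -> F := fun i => \sum_j L i j * x j.

Lemma coords_conj L e r ri x : intertwines L e r -> clmul ri r = clone ->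
  coords (clmul (clmul ri (xvec x)) r) = lact L x.
Proof.
move=> [V1 _ _ _] rr; rewrite -clmulA {1}/xvec clmul_suml.
under eq_bigr => j _ do rewrite clmulZl V1 -clmulZr.
rewrite -clmul_sumr clmulA rr clmul1l -xvec_sum.
apply: functional_extensionality => i; rewrite /coords xvecE.
by apply: eq_bigr => j _; rewrite mulrC.
Qed.

End Pin.

(** * Evaluation and the H-action *)

Lemma poly_eq_horner (F : numFieldType) (p q : {poly F}) :
  (forall t, p.[t] = q.[t]) -> p = q.
Proof.
move=> H; apply/eqP; rewrite -subr_eq0; apply/eqP.
(* In characteristic zero the natural numbers supply as many distinct roots as needed. *)
pose rs := [seq l%:R : F | l <- iota 0 (size (p - q))].
apply: (@roots_geq_poly_eq0 _ _ rs).
- by apply/allP=> t _; rewrite /root hornerD hornerN H addrN.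
- by rewrite map_inj_uniq ?iota_uniq // => l l' /eqP; rewrite eqr_nat => /eqP.
- by rewrite size_map size_iota.
Qed.

Lemma deriv_prod (R : comNzRingType) (I : finType) (f : I -> {poly R}) :
  (\prod_i f i)^`() = \sum_j (f j)^`() * \prod_(i | i != j) f i.
Proof.
have E (s : seq I) : uniq s ->
    (\prod_(i <- s) f i)^`() = \sum_(j <- s) (f j)^`() * \prod_(i <- s | i != j) f i.
  elim: s => [_|i s IH /andP[/= nis /IH{}IH]]; first by rewrite !big_nil derivC.
  rewrite !big_cons derivM IH eqxx /= mulr_sumr; congr (_ + _).
    congr (_ * _); rewrite big_seq [RHS]big_seq_cond; apply: eq_bigl => l.
    by case: (boolP (l \in s)) => //= ls; apply/esym; apply: contraNneq nis => <-.
  rewrite big_seq [RHS]big_seq; apply: eq_bigr => j js.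
  rewrite big_cons ifT ?mulrA ?[f i * _]mulrC // eq_sym.
  by apply: contraNneq nis => <-.
by apply: E; exact: index_enum_uniq.
Qed.

Section Evaluation.
Variables (F : numFieldType) (n k : nat).
Local Notation m := n.+1.
Local Notation last := (@ord_max n).
Local Notation box := {ffun 'I_m -> 'I_k.+1}.
Implicit Types (P Q p q : cpoly F m) (al : mi m) (x v : 'I_m -> F) (i j l : 'I_m).

Definition toN (a : box) : mi m := [ffun i => nat_of_ord (a i)].
Definition mono x al : F := \prod_i x i ^+ al i.
(* Unlike [peval k], this evaluates every polynomial of degree at most [k], which is
   what makes it stable under differentiation. *)
Definition pev P x : Cl F m := \sum_(a : box) clscale (mono x (toN a)) (P (toN a)).
Definition degle P : Prop := forall al, (k < \sum_i al i)%N -> P al = 0.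
Definition incn j (d : nat) al : mi m := [ffun i => (al i + (i == j) * d)%N].

Lemma homog_degle P d : (forall al, P al != 0 -> (\sum_i al i + d = k)%N) -> degle P.
Proof.
by move=> H al kal; apply/eqP/negPn/negP => /H; lia.
Qed.

Lemma peval_pev P x : homog k P -> peval k P x = pev P x.
Proof.
move=> H; rewrite /peval big_mkcond; apply: eq_bigr => a _.
have E : mono x (toN a) = \prod_i x i ^+ a i by apply: eq_bigr => i _; rewrite ffunE.
rewrite E; case: ifPn => // ak; have [->|/H E'] := eqVneq (P (toN a)) 0; first by rewrite clscale0.
by case/negP: ak; rewrite -[X in _ == X]E'; apply/eqP; apply: eq_bigr => i _; rewrite ffunE.
Qed.

Lemma sum_incn j d al : (\sum_i incn j d al i = \sum_i al i + d)%N.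
Proof.
under eq_bigr => i _ do rewrite ffunE.
rewrite big_split /=; congr (_ + _)%N.
by rewrite (bigD1 j) //= eqxx mul1n big1 ?addn0 // => i /negPf ->.
Qed.

(** Translation by [d] is a bijection between the multi-indices that stay in the box and those with
    [j]-th exponent at least [d]. A multi-index pushed out of the box has total degree above [k],
    where [g] vanishes. *)
Lemma box_shift (V : zmodType) (g : mi m -> V) j d :
  (forall al, (k < \sum_i al i)%N -> g al = 0) ->
  \sum_(a : box | (d <= a j)%N) g (toN a) = \sum_(a : box) g (incn j d (toN a)).
Proof.
move=> g0.
pose h (b : box) : box := [ffun l => inord (b l + (l == j) * d)%N].
pose h' (a : box) : box := [ffun l => inord (a l - (l == j) * d)%N].
have vI e : (e <= k)%N -> (inord e : 'I_k.+1) = e :> nat by move=> ek; rewrite inordK.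
rewrite (reindex_onto h h'); last first.
  move=> a da; apply/ffunP=> l; apply: val_inj; rewrite !ffunE /=.
  have ak : (a l <= k)%N by rewrite -ltnS ltn_ord.
  have dl : ((l == j) * d <= a l)%N by case: eqP => [->|_]; rewrite ?mul1n.
  by rewrite [X in inord (X + _)]vI ?(leq_trans (leq_subr _ _)) // subnK // vI.
rewrite big_mkcond; apply: eq_bigr => b _.
have [bk|bk] := leqP (b j + d) k.
  have lek l : (b l + (l == j) * d <= k)%N.
    have bl : (b l <= k)%N by rewrite -ltnS ltn_ord.
    by case: eqP => [->|_]; rewrite ?mul1n ?mul0n ?addn0.
  rewrite ifT; first by congr g; apply/ffunP=> l; rewrite !ffunE /= vI.
  apply/andP; split; first by rewrite ffunE vI // eqxx mul1n leq_addl.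
  apply/eqP/ffunP=> l; apply: val_inj; rewrite !ffunE /=.
  by rewrite [X in inord (X - _)]vI // addnK vI // -ltnS ltn_ord.
rewrite [RHS]g0; last first.
  by rewrite sum_incn (bigD1 j) //= ffunE (leq_trans bk) // leq_add2r leq_addr.
(* Outside the box [inord] defaults to 0; the condition [d <= 0] would then force [d = 0],
   contradicting that the shift left the box. *)
rewrite ifF //; apply/negP => /andP[]; rewrite ffunE eqxx mul1n /inord /insubd insubF /=; last by rewrite ltnS leqNgt bk.
by rewrite leqn0 => /eqP d0; move: bk (ltn_ord (b j)); rewrite d0; lia.
Qed.

(** Restriction to the line x + t v as a univariate polynomial in t, so that directional derivatives
    become formal derivatives at 0. *)
Definition line_poly (f : mi m -> F) x v : {poly F} :=
  \sum_(a : box) f (toN a) *: \prod_i ((x i)%:P + v i *: 'X) ^+ a i.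

Lemma horner_line P C x v t :
  (line_poly (fun al => P al C) x v).[t] = pev P (fun i => x i + v i * t) C.
Proof.
rewrite /line_poly /pev sum_ffunE horner_sum; apply: eq_bigr => a _.
rewrite hornerZ clscaleE mulrC; congr (_ * _); rewrite horner_prod.
by apply: eq_bigr => i _; rewrite horner_exp hornerD hornerZ hornerX hornerC ffunE.
Qed.

Lemma deriv_line P C x v : degle P ->
  (line_poly (fun al => P al C) x v)^`().[0] = \sum_j v j * pev (pderiv j P) x C.
Proof.
move=> dP; rewrite /line_poly (raddf_sum (@deriv F)) /= horner_sum.
have E (a : box) : (P (toN a) C *: \prod_i ((x i)%:P + v i *: 'X) ^+ a i)^`().[0] =
    \sum_j v j * ((toN a j)%:R * mono x [ffun i => (toN a i - (i == j))%N] * P (toN a) C).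
  rewrite derivZ hornerZ deriv_prod horner_sum mulr_sumr; apply: eq_bigr => j _.
  rewrite deriv_exp derivD derivZ derivX derivC add0r alg_polyC hornerM hornerMn hornerM hornerC.
  rewrite horner_exp hornerD hornerZ hornerX hornerC mulr0 addr0 horner_prod.
  rewrite /mono [X in _ = _ * (_ * X * _)](bigD1 j) //= !ffunE eqxx subn1.
  have -> : \prod_(i | i != j) (((x i)%:P + v i *: 'X) ^+ a i).[0] =
      \prod_(i | i != j) x i ^+ [ffun i0 => (toN a i0 - (i0 == j))%N] i.
    apply: eq_bigr => i ij; rewrite !ffunE (negPf ij) subn0.
    by rewrite horner_exp hornerD hornerZ hornerX hornerC mulr0 addr0.
  rewrite -[_ *+ _]mulr_natl; ring.
rewrite (eq_bigr _ (fun a _ => E a)) exchange_big; apply: eq_bigr => j _ /=; rewrite -mulr_sumr; congr (_ * _).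
pose g al := (al j)%:R * mono x [ffun i => (al i - (i == j))%N] * P al C.
(* Terms with exponent 0 in x_j carry a zero factor; the others are shifted down by one with
   [box_shift]. *)
have -> : \sum_(a : box) g (toN a) = \sum_(a : box | (1 <= a j)%N) g (toN a).
  rewrite [RHS]big_mkcond; apply: eq_bigr => a _; case: ifPn => //.
  by rewrite -leqNgt leqn0 /g ffunE => /eqP ->; rewrite !mul0r.
rewrite box_shift => [|al kal]; last by rewrite /g dP // ffunE mulr0.
rewrite /pev sum_ffunE; apply: eq_bigr => a _; rewrite /g /pderiv !clscaleE.
have -> : incn j 1 (toN a) = inc j (toN a) by apply/ffunP=> i; rewrite !ffunE muln1.
have -> : inc j (toN a) j = (toN a j).+1 by rewrite ffunE eqxx addn1.
have -> : [ffun i => (inc j (toN a) i - (i == j))%N] = toN a.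
  by apply/ffunP=> i; rewrite !ffunE addnK.
by rewrite -/(inc _ _); ring.
Qed.

Lemma cl_decomp (a : Cl F m) : a = \sum_B clscale (a B) (blade B).
Proof.
apply/ffunP=> C; rewrite sum_ffunE (bigD1 C) //= big1 ?addr0 => [|B BC].
  by rewrite !ffunE eqxx mulr1.
by rewrite !ffunE [C == B]eq_sym (negPf BC) mulr0.
Qed.

Lemma cl_linearE T (a : Cl F m) C : cl_linear T -> T a C = \sum_B a B * T (blade B) C.
Proof.
move=> Tlin; rewrite {1}(cl_decomp a) cl_linear_sum // sum_ffunE.
by apply: eq_bigr => B _; rewrite Tlin.2 clscaleE.
Qed.

(* Chain rule, read off the linear terms of both sides along the line [x + t e_j]. *)
Lemma pderiv_transport L T p q : cl_linear T -> degle p -> degle q ->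
  (forall x, pev q x = T (pev p (lact L x))) ->
  forall x j, pev (pderiv j q) x = \sum_i clscale (L i j) (T (pev (pderiv i p) (lact L x))).
Proof.
move=> Tlin dp dq H x j; apply/ffunP=> C.
have E : line_poly (fun al => q al C) x (fun i => (i == j)%:R) =
    \sum_B T (blade B) C *: line_poly (fun al => p al B) (lact L x) (L ^~ j).
  apply: poly_eq_horner => t; rewrite horner_line H cl_linearE // horner_sum.
  apply: eq_bigr => B _; rewrite hornerZ horner_line mulrC; congr (_ * pev p _ B).
  apply: functional_extensionality => i; rewrite /lact.
  under eq_bigr => l _ do rewrite mulrDr.
  rewrite big_split /=; congr (_ + _); rewrite (bigD1 j) //= eqxx mul1r big1 ?addr0 // => l /negPf ->.
  by rewrite mul0r mulr0.
have := congr1 (fun f : {poly F} => f^`().[0]) E.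
rewrite deriv_line // (bigD1 j) //= eqxx mul1r big1 ?addr0 => [->|i /negPf ->]; last by rewrite mul0r.
rewrite (raddf_sum (@deriv F)) /= horner_sum sum_ffunE.
under eq_bigr => B _ do rewrite derivZ hornerZ deriv_line // mulr_sumr.
rewrite exchange_big; apply: eq_bigr => i _; rewrite clscaleE cl_linearE // mulr_sumr.
by apply: eq_bigr => B _; ring.
Qed.

Lemma pev_linear T P x : cl_linear T -> pev (fun al => T (P al)) x = T (pev P x).
Proof.
by move=> Tlin; rewrite /pev cl_linear_sum //; apply: eq_bigr => a _; rewrite Tlin.2.
Qed.

Lemma pev_sum (I : finType) (b : pred I) (f : I -> cpoly F m) x :
  pev (fun al => \sum_(i | b i) f i al) x = \sum_(i | b i) pev (f i) x.
Proof.
rewrite /pev; under eq_bigr => a _ do rewrite clscale_sumr.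
by rewrite exchange_big.
Qed.

Lemma pev_emd P x :
  pev (emd P) x = clmul em (\sum_(j | low j) clmul (vec j) (pev (pderiv j P) x)).
Proof.
rewrite (pev_linear (T := clmul em)); last exact: cl_linear_mul.
rewrite /dunder pev_sum; congr clmul; apply: eq_bigr => j _.
by rewrite (pev_linear (T := clmul (vec j))) //; exact: cl_linear_mul.
Qed.

Lemma cl_linear_conj (r ri : Cl F m) : cl_linear (fun a => clmul (clmul r a) ri).
Proof. by split=> [a b|z a]; rewrite ?clmulDr ?clmulDl ?clmulZr ?clmulZl. Qed.

(** The chain rule collects the e_j into [xvec (L i)], which the second equation of [intertwines]
    trades for [vec i] on the other side of [r]. Moving [em] across [r] then yields the factor
    [e]. *)
Lemma emd_transport L e (r ri : Cl F m) p q : intertwines L e r -> degle p -> degle q ->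
  (forall x, pev q x = clmul (clmul r (pev p (lact L x))) ri) ->
  forall x, pev (emd q) x = clscale e (clmul (clmul r (pev (emd p) (lact L x))) ri).
Proof.
move=> [V1 V2 V3 V4] dp dq H x; rewrite !pev_emd.
set X := fun i => pev (pderiv i p) (lact L x).
have -> : \sum_(j | low j) clmul (vec j) (pev (pderiv j q) x) =
    clmul (clmul r (\sum_(i | low i) clmul (vec i) (X i))) ri.
  under eq_bigr => j _ do
    rewrite (pderiv_transport (cl_linear_conj r ri) dp dq H) clmul_sumr.
  rewrite exchange_big clmul_sumr clmul_suml [RHS]big_mkcond; apply: eq_bigr => i _ /=.
  rewrite lowE; case: eqP => [->|/eqP il] /=.
    (* The last row of [L] vanishes in the low columns, so no derivative in x_m enters. *)
    by rewrite big1 // => j; rewrite lowE => /negPf jl; rewrite V4 jl clscale0l clmul0r.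
  have E : xvec (L i) = \sum_(j | low j) clscale (L i j) (vec j).
    rewrite /xvec (bigD1 last) //= V3 (negPf il) clscale0l add0r.
    by apply: eq_bigl => j; rewrite lowE.
  rewrite clmulA [clmul r (vec i)]V2 E -!clmulA clmul_suml.
  by apply: eq_bigr => j _ /=; rewrite clmulZl clmulZr.
rewrite !clmulA [em]emE V1.
have -> : L ^~ last = fun i => if i == last then e else 0.
  by apply: functional_extensionality => i; rewrite V3.
by rewrite xvec_single clmulZr !clmulZl.
Qed.

Lemma emd_iter_transport L e (r ri : Cl F m) p q d : intertwines L e r -> homog k p -> homog k q ->
  (forall x, pev q x = clmul (clmul r (pev p (lact L x))) ri) ->
  forall x, pev (emd_iter d q) x =
    clscale (e ^+ d) (clmul (clmul r (pev (emd_iter d p) (lact L x))) ri).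
Proof.
move=> HL hp hq H; elim: d => [|d IH] x; first by rewrite expr0 clscale1 H.
have dp : degle (emd_iter d p) by apply: (@homog_degle _ d) => al; exact: emd_iter_homog.
have dq : degle (emd_iter d q) by apply: (@homog_degle _ d) => al; exact: emd_iter_homog.
(* The scalar [e ^+ d] is absorbed into the iterate of [p], so that [emd_transport] applies to the
   rescaled pair. *)
rewrite !emd_iterS exprS -clscaleA -[clscale (e ^+ d) _]clmulZl -[clscale (e ^+ d) _]clmulZr.
have TZ z P y : pev (pscale z P) y = clscale z (pev P y).
  by rewrite (pev_linear (T := clscale z)) //; split=> *; rewrite ?clscaleD // !clscaleA mulrC.
have EZ z P : emd (pscale z P) = pscale z (emd P).
  by apply: functional_extensionality => al; rewrite /emd dunderZ clmulZr.
rewrite -TZ -EZ; apply: emd_transport => //.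
  by move=> al /dp; rewrite /pscale => ->; rewrite clscale0.
by move=> y; rewrite IH TZ clmulZr clmulZl.
Qed.

(** The degree hypothesis keeps the product with the [d]-th power of x_m inside the evaluation
    box. *)
Lemma pev_mulxm d P x : (forall al, P al != 0 -> (\sum_i al i + d = k)%N) ->
  pev (mulxm d P) x = clscale (x last ^+ d) (pev P x).
Proof.
move=> H; pose g al := clscale (mono x al) (mulxm d P al).
have g0 al : (k < \sum_i al i)%N -> g al = 0.
  move=> kal; rewrite /g mulxmE; case: ifP => dl; last by rewrite clscale0.
  have [->|/H] := eqVneq (P (shiftm d al)) 0; first by rewrite clscale0.
  by rewrite sum_shiftm // => E; rewrite E ltnn in kal.
rewrite /pev -[LHS]/(\sum_(a : box) g (toN a)).
have -> : \sum_(a : box) g (toN a) = \sum_(a : box | (d <= a last)%N) g (toN a).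
  rewrite [RHS]big_mkcond; apply: eq_bigr => a _; case: ifPn => // dl.
  by rewrite /g mulxmE ffunE (negPf dl) clscale0.
rewrite box_shift // clscale_sumr; apply: eq_bigr => a _.
rewrite /g mulxmE ffunE eqxx mul1n leq_addl clscaleA; congr (clscale _ (P _)).
  rewrite /mono (bigD1 last) //= [in RHS](bigD1 last) //= !ffunE eqxx mul1n exprD mulrA.
  rewrite [x last ^+ d * _]mulrC; congr (_ * _ * _).
  by apply: eq_bigr => i il; rewrite !ffunE (negPf il) addn0.
apply/ffunP=> i; rewrite !ffunE val_lastE; case: eqP => _; rewrite ?mul1n ?addnK //.
by rewrite addn0.
Qed.

Lemma pev_CK P x : homog k P ->
  pev (CK P) x = \sum_(j < k.+1) clscale ((j`!%:R)^-1 * x last ^+ j) (pev (emd_iter j P) x).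
Proof.
move=> hP; have -> : CK P = fun al => \sum_(j < k.+1) clscale (j`!%:R)^-1 (mulxm j (emd_iter j P) al).
  by apply: functional_extensionality => al; exact: CK_homogE.
rewrite pev_sum; apply: eq_bigr => j _.
rewrite (pev_linear (T := clscale (j`!%:R)^-1)); last first.
  by split=> *; rewrite ?clscaleD // !clscaleA mulrC.
by rewrite pev_mulxm ?clscaleA // => al; exact: emd_iter_homog.
Qed.

Lemma homog_CK P : homog k P -> homog k (CK P).
Proof.
move=> hP al; have [//|nk] := eqVneq (\sum_i al i)%N k.
rewrite (CK_homogE _ hP) big1 ?eqxx // => j _.
rewrite mulxmE; case: ifP => jl; last by rewrite clscale0.
have [->|/(emd_iter_homog hP)] := eqVneq (emd_iter j P (shiftm j al)) 0; first by rewrite clscale0.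
by rewrite sum_shiftm // => E; rewrite E eqxx in nk.
Qed.

Lemma CK_intertwines (r ri : Cl F m) p q : pin_low r ->
  clmul ri r = clone -> homog k p -> homog k q ->
  (forall x, peval k q x = hact_at k r ri p x) ->
  forall x, peval k (CK q) x = hact_at k r ri (CK p) x.
Proof.
move=> /pin_low_intertwines[L [e HL]] rr hp hq H x.
have H' y : pev q y = clmul (clmul r (pev p (lact L y))) ri.
  by rewrite -!peval_pev // H /hact_at (coords_conj _ HL).
rewrite /hact_at (coords_conj _ HL) // !peval_pev; try exact: homog_CK.
rewrite !pev_CK // clmul_sumr clmul_suml; apply: eq_bigr => j _.
rewrite (emd_iter_transport j HL hp hq H') clscaleA clmulZr clmulZl; congr clscale.
(* On one side [e ^+ j] comes from transporting the iterate, on the other from the [j]-th power of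
   this coordinate. *)
have -> : lact L x last = e * x last.
  case: HL => _ _ _ V4; rewrite /lact (bigD1 last) //= V4 eqxx big1 ?addr0 // => l /negPf ll.
  by rewrite V4 ll mul0r.
by rewrite exprMn; ring.
Qed.

End Evaluation.

Theorem theorem2 (F : numFieldType) (m s k : nat) :
  (2 <= m)%N -> (s <= m)%N ->
  (* (i) CK maps I_k^s into H_k^s *)
  (forall p0 : cpoly F m, Ispace k s p0 -> Hks k s (CK p0)) /\
  (* CK is linear on I_k^s *)
  (forall (p0 q0 : cpoly F m) (a b : F), Ispace k s p0 -> Ispace k s q0 ->
     CK (padd (pscale a p0) (pscale b q0)) = padd (pscale a (CK p0)) (pscale b (CK q0))) /\
  (* injective on I_k^s *)
  (forall p0 q0 : cpoly F m, Ispace k s p0 -> Ispace k s q0 -> CK p0 = CK q0 -> p0 = q0) /\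
  (* intertwines the H-action of Pin(m-1) *)
  (forall (r rinv : Cl F m), pin_low r -> clmul r rinv = clone -> clmul rinv r = clone ->
     forall p0 q0 : cpoly F m, Ispace k s p0 -> homog k q0 ->
     (forall x, peval k q0 x = hact_at k r rinv p0 x) ->
     forall x, peval k (CK q0) x = hact_at k r rinv (CK p0) x) /\
  (* (ii) explicit formula *)
  (forall u0 v0 : cpoly F m, Kerplus k s u0 -> Kerminus k (s%:Z - 1) v0 ->
     CK (padd u0 (prmul v0 em)) =
     padd (series k (useq s u0 v0)) (prmul (series k (vseq s u0 v0)) em)) /\
  (* restriction lies in I_k^s and p = CK(p0); hence CK is onto H_k^s *)
  (forall p : cpoly F m, Hks k s p -> Ispace k s (restr p) /\ p = CK (restr p)).
Proof.
case: m => [//|n] _ _; split; first by move=> p0; exact: CK_Hks.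
split; first by move=> p0 q0 a b _ _; exact: CK_lin.
split; first exact: CK_Ispace_inj.
split; last by split; [exact: CK_formula | exact: Hks_restr].
move=> r ri pr _ rr p0 q0 [u [v [Hu [Hv ->]]]] hq; apply: CK_intertwines => //.
by apply: homogD_mulem; [case: Hu => -[[]] | case: Hv => -[[]]].
Qed.
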